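(* The variety $V^7=\{A\in\mathbb{R}^9:\|A\|^2=3,\ \det A=0\}$ of singular $3\times 3$ matrices on $S^8(\sqrt3)$ fails to be a submanifold of $S^8(\sqrt3)$ precisely along the set $M^4$ of matrices of rank $1$; that is, $V^7$ is a submanifold of $S^8(\sqrt3)$ at each of its points of rank $2$, and fails to be a manifold at each of its points of rank $1$.
   Context: Real $3\times3$ matrices are identified with points of Euclidean space $\mathbb{R}^9$ with norm $\|A\|^2=\sum_{i,j}a_{ij}^2$, and $S^8(\sqrt3)$ is the round sphere of matrices of norm $\sqrt3$. $M^4$ denotes the set of matrices of rank $1$ on $S^8(\sqrt3)$. A subset $X$ of $S^8(\sqrt 3)$ is a submanifold (respectively, a manifold) at a point $A\in X$ if some neighborhood of $A$ in $X$ is a submanifold of $S^8(\sqrt 3)$ (respectively, a manifold). *)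

(* Defs.v *)
From HB Require Import structures.
From mathcomp Require Import all_boot all_order all_algebra.
From mathcomp Require Import all_classical all_reals all_analysis.

Set Implicit Arguments.
Unset Strict Implicit.
Unset Printing Implicit Defensive.

Import Order.TTheory GRing.Theory Num.Theory.
Import numFieldNormedType.Exports.

Local Open Scope classical_set_scope.
Local Open Scope ring_scope.

(* X and Y carry their subspace topologies; the values of f outside X and of g
   outside Y are irrelevant. *)
Definition homeomorphism {S T : topologicalType} (X : set S) (Y : set T)
    (f : S -> T) (g : T -> S) : Prop :=
  [/\ f @` X = Y,
      {in X, cancel f g},
      {within X, continuous f} &
      {within Y, continuous g}].

(* X, with its subspace topology, is a topological n-manifold without boundary.
   For subsets of a finite-dimensional normed space the Hausdorff and second
   countability axioms hold automatically. *)
Definition topological_manifold {R : realType} {V : normedModType R}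
    (n : nat) (X : set V) : Prop :=
  forall x, X x -> exists W : set V, [/\ open W, W x &
    exists (Omega : set 'rV[R]_n) f g,
      open Omega /\ homeomorphism (X `&` W) Omega f g].

(* f is of class C^k on the open set U. The domain is meant to be
   finite-dimensional: continuity of x |-> 'd f x in operator norm is then
   equivalent to continuity of x |-> 'd f x v for every v, and likewise for the
   higher derivatives. *)
Fixpoint class_C {R : realType} {V W : normedModType R}
    (k : nat) (U : set V) (f : V -> W) : Prop :=
  if k is k'.+1 then
    (forall x, U x -> differentiable f x) /\
    (forall v, class_C k' U (fun x => 'd f x v))
  else forall x, U x -> {for x, continuous f}.

(* Smoothness on an arbitrary subset X: near each point of X, f is the
   restriction to X of a C^infinity map defined on an open set. *)
Definition smooth_on {R : realType} {V W : normedModType R}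
    (X : set V) (f : V -> W) : Prop :=
  forall x, X x -> exists (U : set V) (F : V -> W),
    [/\ open U, U x, forall k, class_C k U F &
        forall y, X y -> U y -> F y = f y].

Definition diffeomorphism {R : realType} {V W : normedModType R}
    (X : set V) (Y : set W) (f : V -> W) (g : W -> V) : Prop :=
  [/\ f @` X = Y, {in X, cancel f g}, smooth_on X f & smooth_on Y g].

(* The linear subspace R^k x 0 of R^d. *)
Definition coord_subspace {R : realType} (d k : nat) : set 'rV[R]_d :=
  [set y | forall i : 'I_d, (k <= i)%N -> y ord0 i = 0].

(* N is a k-dimensional (embedded, smooth) submanifold of the d-dimensional
   submanifold S of V: around each of its points S has a smooth chart
   f : S `&` W -> Omega, with inverse g, that carries N onto the slice
   Omega `&` (R^k x 0). *)
Definition submanifold {R : realType} {V : normedModType R}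
    (d : nat) (S : set V) (k : nat) (N : set V) : Prop :=
  [/\ N `<=` S, (k <= d)%N &
    forall x, N x -> exists W : set V, [/\ open W, W x &
      exists (Omega : set 'rV[R]_d) f g,
        [/\ open Omega, diffeomorphism (S `&` W) Omega f g &
            f @` (N `&` W) = Omega `&` coord_subspace k]]].

Definition nbhd_in {T : topologicalType} (X : set T) (x : T) (N : set T) :
  Prop := N `<=` X /\ within X (nbhs x) N.

Definition manifold_at {R : realType} {V : normedModType R}
    (X : set V) (x : V) : Prop :=
  exists (N : set V) (n : nat), nbhd_in X x N /\ topological_manifold n N.

Definition submanifold_at {R : realType} {V : normedModType R}
    (d : nat) (S X : set V) (x : V) : Prop :=
  exists (N : set V) (k : nat), nbhd_in X x N /\ submanifold d S k N.

(* The library norm `|A| on matrices is the sup norm: it induces the Euclidean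
   topology and the same differential calculus, but not the Euclidean norm. *)
Definition euclidean_norm {R : realType} (A : 'M[R]_3) : R :=
  Num.sqrt (\sum_i \sum_j A i j ^+ 2).

Definition S8 {R : realType} : set 'M[R]_3 :=
  [set A | euclidean_norm A = Num.sqrt 3].

Definition V7 {R : realType} : set 'M[R]_3 :=
  [set A | euclidean_norm A ^+ 2 = 3 /\ \det A = 0].

Definition M4 {R : realType} : set 'M[R]_3 :=
  [set A | S8 A /\ \rank A = 1%N].

(* Main.v *)
Require Import Defs.
From HB Require Import structures.
From mathcomp Require Import all_boot all_order all_algebra.
From mathcomp Require Import all_classical all_reals all_analysis.
From mathcomp Require Import ring lra zify.

Set Implicit Arguments.
Unset Strict Implicit.
Unset Printing Implicit Defensive.

Import Order.TTheory GRing.Theory Num.Theory.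
Import numFieldNormedType.Exports.
Local Open Scope classical_set_scope.
Local Open Scope ring_scope.

(** Let A be a singular matrix on the sphere, of rank r. Gaussian elimination
gives invertible L and M with A = L I_r M, where I_r is the partial identity,
and nearby matrices B are described by their entries C = L^-1 B M^-1 ([frame]).
Both the position of the point and the equation det B = 0 survive scaling, so
near A the sphere may be replaced by the affine hyperplane C00 = 1.

If r = 2, the leading 2 x 2 minor of C does not vanish near A. On the
hyperplane the determinant is an affine function of the entry C22 whose slope is
that minor, hence the seven other entries together with the determinant are
smooth coordinates in which the singular matrices form a coordinate slice
([slice_submanifold]).

If r = 1, a matrix with C00 = 1 is singular exactly when its 2 x 2 Schur
complement S is, so near A the variety is the product of R^4 and the cone of
singular 2 x 2 matrices, a cone over a torus. The linear map
S |-> (S11 + S22, S21 - S12) sends this cone to R^2, vanishes on it only at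
S = 0, and has the linear section that fills the first column. Keeping the four
other coordinates yields maps s : R^6 -> V7 and p : V7 -> R^6, defined near 0
and A, such that p o s is the identity and A is the only zero of p
([cone_sectionK], [cone_proj_eq0]).

Suppose that the variety is an n-manifold at A. A translation inside a chart
carries A to a nearby matrix of rank 2, at which the variety is a 7-manifold;
whatever n is, the variety is then locally homeomorphic to R^7 at A
([locally_euclidean_homogeneous]). Transported to R^7, the pair (s, p) contradicts
[stable_section_dim]: a map from a 6-cube to R^7 can be moved off the origin by
an arbitrarily small perturbation ([lipschitz_approx], [lipschitz_misses]),
after which its composite with p is a map without zeros close to the identity
of the cube. The Poincare-Miranda theorem forbids such a map. It is derived here
from a count modulo 2 of cells of a grid: a cup product of coboundaries, summed
over the whole grid, reduces by Stokes' formula to the boundary, where its value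
is known ([box_sum_cup]). *)

(** * A combinatorial Poincare-Miranda theorem *)

Section Cup.
Variable n : nat.
Local Notation grid := {ffun 'I_n -> nat}.

Definition step (d : 'I_n) : grid := [ffun j => (j == d) : nat].

Lemma add_stepn (x : grid) d t j : (x + step d *+ t) j = (x j + (j == d) * t)%N.
Proof.
rewrite !ffunE ffunMnE ffunE; case: eqP => _; last by rewrite mul0rn mul0n.
by rewrite mul1n -[in RHS](natn t).
Qed.

Lemma add_step (x : grid) d j : (x + step d) j = (x j + (j == d))%N.
Proof. by rewrite -[step d]mulr1n add_stepn muln1. Qed.

Lemma addF2 (x : 'F_2) : x + x = 0.
Proof. exact: (@addrr_pchar2 'F_2 (pchar_Fp (isT : prime 2))). Qed.

Lemma symmetric_sum0 (D : {set 'I_n}) (G : 'I_n -> 'I_n -> 'F_2) :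
  (forall d e, G d e = G e d) ->
  \sum_(d in D) \sum_(e in D :\ d) G d e = 0.
Proof.
move=> symG.
under eq_bigr => d _ do rewrite (bigID (fun e : 'I_n => (e < d)%N)) /=.
rewrite big_split /=.
rewrite [X in X + _](exchange_big_dep (mem D)) /=; last first.
  by move=> d e _ /andP[]; rewrite in_setD1 => /andP[].
rewrite -[RHS](addF2 (\sum_(d in D) \sum_(e in D :\ d | ~~ (e < d)%N) G d e)).
congr (_ + _); apply: eq_bigr => d dD; apply: eq_big => e; last by rewrite symG.
rewrite !in_setD1 dD /= -leqNgt ltn_neqAle eq_sym -val_eqE.
have -> : (\val e != \val d) = (d != e :> nat) by rewrite eq_sym.
by rewrite andbT; case: (e \in D); case: (_ != _).
Qed.

(** The value, on the cube with lowest vertex x spanned by the directions in D,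
of the cup product of the coboundaries of the functions in us: a sum over the
monotone edge paths from x, where the j-th function is differentiated along the
j-th edge. The cochain has as many factors as the cube has directions;
coefficients modulo 2 spare all the signs. *)
Fixpoint cup (us : seq (grid -> 'F_2)) (D : {set 'I_n}) (x : grid) : 'F_2 :=
  if us is u :: us' then
    \sum_(d in D) (u (x + step d) + u x) * cup us' (D :\ d) (x + step d)
  else 1.

(** A product of coboundaries is a cocycle: its values on the faces of a cube
add up to 0. The double sums that are symmetric in two directions cancel
modulo 2. *)
Lemma cup_closed us (D : {set 'I_n}) (x : grid) :
  \sum_(d in D) cup us (D :\ d) (x + step d) = \sum_(d in D) cup us (D :\ d) x.
Proof.
elim: us D x => [//|u us IH] D x /=.
pose G d e := u (x + step d + step e) * cup us (D :\ d :\ e) (x + step d + step e).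
pose G' d e := cup us (D :\ d :\ e) (x + step d + step e).
have setD1C (d e : 'I_n) : D :\ d :\ e = D :\ e :\ d.
  by apply/setP => j; rewrite !inE andbCA.
have symG d e : G d e = G e d by rewrite /G addrAC setD1C.
have symG' d e : G' d e = G' e d by rewrite /G' addrAC setD1C.
under eq_bigr => d _ do
  (under eq_bigr => e _ do rewrite mulrDl -/(G d e); rewrite big_split -mulr_sumr /=).
rewrite big_split /= symmetric_sum0 // add0r.
under [RHS]eq_bigr => d _ do
  (under eq_bigr => e _ do rewrite mulrDl setD1C; rewrite big_split -mulr_sumr /=).
rewrite big_split /= -mulr_sumr.
rewrite [X in _ = _ + _ * X](exchange_big_dep (mem D)) /=; last first.
  by move=> d e _; rewrite in_setD1 => /andP[].
rewrite [X in _ = _ + _ * X](_ : _ = 0) ?mulr0 ?addr0; last first.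
  rewrite -[RHS](symmetric_sum0 D symG'); apply: eq_bigr => d dD.
  rewrite [RHS](IH (D :\ d) (x + step d)); apply: eq_bigl => e.
  by rewrite !in_setD1 dD eq_sym andbT andbC.
rewrite [RHS](exchange_big_dep (mem D)) /=; last first.
  by move=> d e _; rewrite in_setD1 => /andP[].
apply: eq_bigr => d dD; rewrite IH mulr_sumr; apply: eq_bigl => e.
by rewrite !in_setD1 dD eq_sym andbT andbC.
Qed.

(** The product of the coboundary of u with a cocycle c is the coboundary of
u c, so its value on a cube is the sum of u c over the faces. *)
Lemma cup_stokes u us (D : {set 'I_n}) (x : grid) :
  cup (u :: us) D x =
  \sum_(d in D) (u (x + step d) * cup us (D :\ d) (x + step d)
                 + u x * cup us (D :\ d) x).
Proof.
rewrite big_split /= -mulr_sumr -cup_closed mulr_sumr -big_split /=.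
by apply: eq_bigr => d _; rewrite mulrDl.
Qed.

(** One function that is constant on the vertices of the cube kills the product.
This is used both on the faces of the grid and to read a sign change off a
nonzero value. *)
Lemma cup_const us u (D : {set 'I_n}) (x : grid) : 
  (forall y : grid, (forall j, x j <= y j <= x j + (j \in D))%N -> u y = u x) ->
  List.In u us -> cup us D x = 0.
Proof.
elim: us D x => //= v us IH D x cst vu; apply: big1 => d dD.
have inD j : (x j <= (x + step d)%R j <= x j + (j \in D))%N.
  rewrite add_step; case: (eqVneq j d) => [->|_]; first by rewrite dD; lia.
  by case: (j \in D); lia.
case: vu => [->|uin]; first by rewrite cst ?addF2 ?mul0r.
rewrite IH ?mulr0 // => y yin; rewrite (cst (x + step d)) //; apply: cst => j.
have := yin j; rewrite add_step in_setD1.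
case: (eqVneq j d) => [->|_] /=; rewrite ?dD /= ?addn0 //.
by case/andP=> h ->; rewrite andbT (leq_trans _ h) ?leq_addr.
Qed.

Variable k : nat.

Fixpoint box_sum (s : seq 'I_n) (H : grid -> 'F_2) (x : grid) : 'F_2 :=
  if s is d :: s' then \sum_(t < k) box_sum s' H (x + step d *+ t) else H x.

Lemma eq_box_sum s (H H' : grid -> 'F_2) x : H =1 H' -> box_sum s H x = box_sum s H' x.
Proof. by move=> e; elim: s x => //= d s IH x; apply: eq_bigr => t _. Qed.

Lemma box_sum_sum s (D : {set 'I_n}) (H : 'I_n -> grid -> 'F_2) x :
  box_sum s (fun y => \sum_(d in D) H d y) x = \sum_(d in D) box_sum s (H d) x.
Proof.
elim: s x => //= d s IH x; rewrite exchange_big /=.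
by apply: eq_bigr => t _; rewrite IH.
Qed.

Lemma box_sumD s (H H' : grid -> 'F_2) x :
  box_sum s (fun y => H y + H' y) x = box_sum s H x + box_sum s H' x.
Proof.
by elim: s x => //= d s IH x; rewrite -big_split; apply: eq_bigr => t _.
Qed.

Lemma box_sum_shift s (H : grid -> 'F_2) v x :
  box_sum s (fun y => H (y + v)) x = box_sum s H (x + v).
Proof.
by elim: s x => //= d s IH x; apply: eq_bigr => t _; rewrite IH addrAC.
Qed.

Lemma box_sum_rem d s (H : grid -> 'F_2) x : d \in s ->
  box_sum s H x = box_sum (d :: rem d s) H x.
Proof.
elim: s x => //= a s IH x; rewrite in_cons.
case: (eqVneq a d) => [->//|ad] /= ds.
under eq_bigr => t _ do rewrite IH //=.
rewrite exchange_big; apply: eq_bigr => t _; apply: eq_bigr => t' _.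
by rewrite addrAC.
Qed.

Lemma box_sum_telescope d s (H : grid -> 'F_2) x :
  box_sum (d :: s) (fun y => H (y + step d) + H y) x =
  box_sum s H (x + step d *+ k) + box_sum s H x.
Proof.
rewrite /=; elim: k => [|m IH]; first by rewrite big_ord0 addr0 addF2.
rewrite big_ord_recr /= IH box_sumD box_sum_shift.
rewrite -[x + _ + step d]addrA -mulrSr [X in X + _]addrC addrACA addF2 addr0.
exact: addrC.
Qed.

Lemma box_sum_eq0 s (H : grid -> 'F_2) (b : grid) : uniq s ->
  (forall y : grid,
    (forall j, (j \notin s -> y j = b j) /\ (j \in s -> b j <= y j < b j + k)%N) ->
    H y = 0) ->
  box_sum s H b = 0.
Proof.
elim: s b => /= [|d s IH] b; first by move=> _; apply=> j.
case/andP=> ds us H0; apply: big1 => t _; apply: IH => // y yin; apply: H0 => j.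
have [] := yin j; rewrite add_stepn in_cons.
case: (eqVneq j d) => [->|_] /=.
  by rewrite (negPf ds); have := ltn_ord t; split=> //; lia.
by rewrite mul0n addn0.
Qed.

Local Arguments box_sum : simpl never.

(** Induction on the number of directions. Stokes' formula and telescoping turn
the sum into contributions of the faces of the box. On a face orthogonal to a
direction d other than i, the function u d is constant and the product
vanishes; on the lower face orthogonal to i the factor u i is 0, and on the
upper one it is 1, which leaves the statement for the remaining directions. *)
Lemma box_sum_cup (u : 'I_n -> grid -> 'F_2) s (b : grid) :
  (forall i (x : grid), (forall j, x j <= k)%N -> x i = 0%N -> u i x = 0) ->
  (forall i (x : grid), (forall j, x j <= k)%N -> x i = k -> u i x = 1) ->
  uniq s -> (forall j, b j <= k)%N -> (forall j, j \in s -> b j = 0%N) ->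
  box_sum s (cup (map u s) [set j in s]) b = 1.
Proof.
move=> u0 u1; elim: s b => [//|i s IH] b us bk b0.
have /andP[iNs us'] : (i \notin s) && uniq s by [].
set D := [set j in i :: s].
pose H d y := u i y * cup (map u s) (D :\ d) y.
rewrite (@eq_box_sum _ _ (fun y => \sum_(d in D) (H d (y + step d) + H d y))); last first.
  by move=> y; rewrite -/([seq u j | j <- i :: s]) cup_stokes.
rewrite box_sum_sum (bigD1 i) ?inE ?eqxx //=.
rewrite [X in _ + X]big1 ?addr0; last first.
  move=> d /andP[]; rewrite inE => ds di.
  rewrite (@box_sum_rem d) // box_sum_telescope.
  have ds' : d \in s by move: ds; rewrite in_cons (negPf di).
  have H0 (c : grid) : (forall j, c j <= k)%N -> (forall j, j != d -> c j = b j) ->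
      (c d = 0%N \/ c d = k) -> box_sum (rem d (i :: s)) (H d) c = 0.
    move=> ck cb cd; apply: box_sum_eq0; first exact: rem_uniq.
    move=> y yin; rewrite /H (@cup_const _ (u d)) ?mulr0 //; last first.
      elim: (s) ds' => //= a s' IHs.
      by rewrite in_cons => /orP[/eqP->|/IHs]; [left|right].
    move=> z zin.
    have yd : y d = c d by case: (yin d) => -> //; rewrite mem_rem_uniqF.
    have zd : z d = c d.
      have := zin d; rewrite !inE eqxx /= addn0 yd => ?.
      by apply/eqP; rewrite eqn_leq andbC.
    have yk j : (y j + (j \in D :\ d) <= k)%N.
      rewrite in_setD1 inE; case: (yin j); rewrite mem_rem_uniq // inE.
      have [->|jd] /= := eqVneq j d; first by move=> -> //; rewrite addn0.
      case jD: (j \in i :: s) => /=; last by move=> -> //; rewrite addn0.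
      by move=> _ /(_ isT); rewrite cb // b0 //; lia.
    have yk' j : (y j <= k)%N := leq_trans (leq_addr _ _) (yk j).
    have zk j : (z j <= k)%N by case/andP: (zin j) => _ /leq_trans; apply.
    by case: cd => cd; [rewrite !u0|rewrite !u1]; rewrite ?zd ?yd.
  rewrite !H0 ?addr0 //.
  - by left; apply: b0.
  - move=> j; rewrite add_stepn; case: eqP => [->|_]; first by rewrite b0 // mul1n.
    by rewrite mul0n addn0.
  - by move=> j /negPf jd; rewrite add_stepn jd mul0n addn0.
  - by right; rewrite add_stepn eqxx mul1n b0.
rewrite box_sum_telescope.
have Di : D :\ i = [set j in s].
  apply/setP => j; rewrite !inE; case: (eqVneq j i) => [->|] //=.
  by rewrite (negPf iNs).
have HE (c : grid) (v : 'F_2) : (forall j, c j <= k)%N -> (forall j, j \in s -> c j = 0%N) ->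
    (forall y : grid, (forall j, y j <= k)%N -> y i = c i -> u i y = v) ->
    box_sum s (H i) c = v.
  move=> ck c0 uv.
  transitivity (box_sum s (fun y => v * cup (map u s) [set j in s] y) c).
    have := @box_sum_eq0 s (fun y => H i y + v * cup (map u s) [set j in s] y) c us'.
    rewrite box_sumD => E0.
    apply/eqP; rewrite -subr_eq0; apply/eqP; rewrite -[RHS]E0.
      congr (_ + _); apply/eqP; rewrite eq_sym -subr_eq0 opprK; apply/eqP.
      exact: addF2.
    move=> y yin; rewrite /H Di uv ?addF2 //; last first.
      by case: (yin i) => -> .
    move=> j; case: (yin j); case js: (j \in s); last by move=> ->.
    by move=> _ /(_ isT); rewrite c0 //; lia.
  have -> (w : 'F_2) F x : box_sum s (fun y => w * F y) x = w * box_sum s F x.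
    by elim: (s) x => //= a s' IHs x; rewrite mulr_sumr; apply: eq_bigr => t _.
  by rewrite IH // mulr1.
rewrite (HE _ 1) ?(HE _ 0) ?addr0 //.
- by move=> j js; apply: b0; rewrite in_cons js orbT.
- by move=> y yk yi; apply: u0 => //; rewrite yi b0 // mem_head.
- move=> j; rewrite add_stepn; case: eqP => [->|_]; last by rewrite mul0n addn0.
  by rewrite b0 ?mem_head // mul1n.
- move=> j js; rewrite add_stepn b0 ?in_cons ?js ?orbT //.
  by case: eqP js => [->|_]; rewrite ?(negPf iNs).
- by move=> y yk yi; apply: u1 => //; rewrite yi add_stepn eqxx mul1n b0 ?mem_head.
Qed.

Theorem discrete_poincare_miranda (u : 'I_n -> grid -> bool) :
  (forall i (x : grid), (forall j, x j <= k)%N -> x i = 0%N -> u i x = false) ->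
  (forall i (x : grid), (forall j, x j <= k)%N -> x i = k -> u i x = true) ->
  exists2 x : grid, (forall j, x j < k)%N &
    forall i, exists2 y : grid, (forall j, x j <= y j <= (x j).+1)%N & u i y != u i x.
Proof.
move=> u0 u1.
pose v i x : 'F_2 := (u i x)%:R.
have := @box_sum_cup v (enum 'I_n) 0.
set S := box_sum _ _ _ => S1.
have {}S1 : S = 1.
  apply: S1 => [i x xk xi|i x xk xi||j|j _]; rewrite ?ffunE ?enum_uniq //.
    by rewrite /v u0.
  by rewrite /v u1.
apply: contrapT => noX; suff : S = 0 by rewrite S1 => /eqP; rewrite oner_eq0.
apply: box_sum_eq0 => [|x xin]; first exact: enum_uniq.
have xk j : (x j < k)%N.
  by case: (xin j) => _; rewrite mem_enum ffunE => /(_ isT) /andP[].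
have /existsNP[i iP] : ~ forall i, exists2 y : grid,
    (forall j, x j <= y j <= (x j).+1)%N & u i y != u i x.
  by move=> allX; apply: noX; exists x.
apply: (@cup_const _ (v i)); last first.
  have : i \in enum 'I_n by rewrite mem_enum.
  by elim: (enum 'I_n) => //= a s IHs; rewrite in_cons => /orP[/eqP->|/IHs];
    [left|right].
move=> y yin; rewrite /v; congr (_%:R); congr nat_of_bool.
apply/eqP/negPn/negP => uyx; apply: iP; exists y => // j.
by have := yin j; rewrite inE mem_enum addn1.
Qed.
End Cup.

(** * The Poincare-Miranda theorem *)

Section Cube.
Context {R : realType}.

Lemma mx_norm_le m n (A : 'M[R]_(m, n)) e : 0 <= e ->
  `|A| <= e <-> forall i j, `|A i j| <= e.
Proof.
move=> e0; rewrite [`|A|]mx_normrE; split.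
  by move=> /bigmax_leP[_ Ae] i j; apply: (Ae (i, j)).
by move=> Ae; apply/bigmax_leP; split => // -[i j] _; exact: Ae.
Qed.

Lemma mx_norm_lt m n (A : 'M[R]_(m, n)) e : 0 < e ->
  `|A| < e <-> forall i j, `|A i j| < e.
Proof.
move=> e0; rewrite [`|A|]mx_normrE; split.
  by move=> /bigmax_ltP[_ Ae] i j; apply: (Ae (i, j)).
by move=> Ae; apply/bigmax_ltP; split => // -[i j] _; exact: Ae.
Qed.

Lemma coord_norm m n (A : 'M[R]_(m, n)) i j : `|A i j| <= `|A|.
Proof. exact: (mx_norm_le A (normr_ge0 _)).1. Qed.

Lemma compact_cube m (e : R) : compact [set x : 'rV[R]_m | `|x| <= e].
Proof.
apply: bounded_closed_compact.
  exists e; split; first exact: num_real.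
  by move=> M eM x /= /le_trans; apply; exact: ltW.
have -> : [set x : 'rV[R]_m | `|x| <= e] = ((fun x => `|x|) @^-1` [set y : R | y <= e]) by [].
apply: closed_comp; last exact: closed_le.
by move=> x _; apply: norm_continuous.
Qed.

(** Only x is confined to K: the continuity of f at the points of K is that of
the ambient space, so y may leave K. *)
Lemma uniformly_continuous (V W : normedModType R) (K : set V) (f : V -> W) (eta : R) :
  compact K -> (forall x, K x -> {for x, continuous f}) -> 0 < eta ->
  exists2 delta : R, 0 < delta &
    forall x y, K x -> `|x - y| < delta -> `|f x - f y| < eta.
Proof.
move=> cK fK eta0.
have /compact_near_coveringP/(_ R 0^'+
  (fun d x => forall y, `|x - y| < d -> `|f x - f y| < eta) _) := cK.
case=> [x Kx|/= d d0 dK].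
  have eta2 : 0 < eta / 2 by rewrite divr_gt0.
  have /cvgrPdist_lt/(_ _ eta2) := fK x Kx.
  rewrite /prop_near1 -filter_from_ballE => -[/= e e0 xe].
  have e2 : 0 < e / 2 by rewrite divr_gt0.
  exists (ball x (e / 2), [set d | 0 < d < e / 2]) => [|[x' d] /= [xx' /andP[d0 de]] y x'y].
    split; first exact: nbhsx_ballx.
    near=> d; apply/andP; split; near: d; [exact: nbhs_right_gt|exact: nbhs_right_lt].
  have fx' : `|f x - f x'| < eta / 2.
    by apply: xe; apply: le_ball xx'; rewrite ler_pdivrMr // ler_pMr // ?ler1n.
  have fy : `|f x - f y| < eta / 2.
    apply: xe; rewrite -ball_normE /= -[x - y](subrKA x').
    rewrite (splitr e) (le_lt_trans (ler_normD _ _)) // ltrD //.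
      by move: xx'; rewrite -ball_normE.
    exact: lt_trans de.
  rewrite -[f x' - f y](subrKA (f x)) (splitr eta).
  by rewrite (le_lt_trans (ler_normD _ _)) // ltrD // distrC.
exists (d / 2); first by rewrite divr_gt0.
move=> x y Kx xy; apply: (dK (d / 2)) => //=.
  by rewrite sub0r normrN gtr0_norm ?divr_gt0 // ltr_pdivrMr // ltr_pMr // ltr1n.
by rewrite divr_gt0.
Unshelve. all: by end_near. Qed.

(** If G has no zero on the cube, then near each point some coordinate of G keeps
a strict sign; by compactness this holds on all balls of some radius d. A grid
of mesh smaller than d / 2 then has no cell on which every coordinate of G
changes sign. *)
Theorem poincare_miranda m (G : 'rV[R]_m -> 'rV[R]_m) (e : R) : 0 < e ->
  (forall x, `|x| <= e -> {for x, continuous G}) ->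
  (forall (x : 'rV[R]_m) i, `|x| <= e -> x ord0 i = - e -> G x ord0 i <= 0) ->
  (forall (x : 'rV[R]_m) i, `|x| <= e -> x ord0 i = e -> 0 < G x ord0 i) ->
  exists2 x, `|x| <= e & G x = 0.
Proof.
move=> e0 Gc Gneg Gpos; apply: contrapT => noz.
pose C := [set x : 'rV[R]_m | `|x| <= e].
have /compact_near_coveringP/(_ R 0^'+
  (fun d x => C x -> exists i, forall y, `|x - y| < d ->
      (0 < G x ord0 i) = (0 < G y ord0 i)) _) := @compact_cube m e.
case=> [x Cx|/= d d0 dC].
  have [i Gi] : exists i, G x ord0 i != 0.
    apply: contrapT => nG; apply: noz; exists x => //; apply/rowP => i.
    by rewrite mxE; apply/eqP/negPn/negP => ?; apply: nG; exists i.
  have Gi0 : 0 < `|G x ord0 i| by rewrite normr_gt0.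
  have /cvgrPdist_lt/(_ _ Gi0) := Gc x Cx.
  rewrite /prop_near1 -filter_from_ballE => -[/= r r0 xr].
  have r2 : 0 < r / 2 by rewrite divr_gt0.
  exists (ball x (r / 2), [set d | 0 < d < r / 2]) => [|[x' d] /= [xx' /andP[d0 de]] Cx'].
    split; first exact: nbhsx_ballx.
    near=> d; apply/andP; split; near: d; [exact: nbhs_right_gt|exact: nbhs_right_lt].
  exists i.
  have sgn y : ball x r y -> (0 < G y ord0 i) = (0 < G x ord0 i).
    move=> /xr /(le_lt_trans (coord_norm _ ord0 i)); rewrite !mxE.
    by case: (ltrgt0P (G x ord0 i)) Gi => // h _; rewrite ltr_norml => /andP[? ?]; lra.
  move=> y x'y; rewrite !sgn //.
    rewrite -ball_normE /= -[x - y](subrKA x').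
    rewrite (splitr r) (le_lt_trans (ler_normD _ _)) // ltrD //.
      by move: xx'; rewrite -ball_normE.
    exact: lt_trans de.
  by apply: le_ball xx'; rewrite ler_pdivrMr // ler_pMr // ?ler1n.
(* k cells on each side make the mesh 2 * e / k smaller than d / 2 *)
set k := (Num.truncn (4 * e / d)).+1.
have k0 : 0 < k%:R :> R by rewrite ltr0n.
have hd : 2 * e / k%:R < d / 2.
  have : 4 * e / d < k%:R by exact: truncnS_gt.
  by rewrite ltr_pdivrMr // ltr_pdivrMr // => ?; lra.
pose pt (x : {ffun 'I_m -> nat}) : 'rV[R]_m :=
  \row_j (- e + 2 * e / k%:R * (x j)%:R).
have h0 : 0 < 2 * e / k%:R by rewrite divr_gt0 // mulr_gt0.
have hk : 2 * e / k%:R * k%:R = 2 * e by rewrite divfK // gt_eqF.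
have ptC (x : {ffun 'I_m -> nat}) : (forall j, x j <= k)%N -> C (pt x).
  move=> xk; apply/mx_norm_le; first exact: ltW.
  move=> i j; rewrite mxE ler_norml.
  have : 0 <= 2 * e / k%:R * (x j)%:R by rewrite mulr_ge0 ?ler0n ?ltW.
  have : 2 * e / k%:R * (x j)%:R <= 2 * e / k%:R * k%:R by rewrite ler_pM2l // ler_nat.
  by rewrite hk => ? ?; apply/andP; split; lra.
have [i x xk xi|i x xk xi|x xk cell] :=
    @discrete_poincare_miranda m k (fun i x => 0 < G (pt x) ord0 i).
- apply/negbTE; rewrite -leNgt; apply: Gneg; first exact: ptC.
  by rewrite mxE xi mulr0 addr0.
- by apply: Gpos; [exact: ptC|rewrite mxE xi hk; lra].
have [||||i iP] := dC (d / 2) _ _ (pt x).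
- by rewrite /= sub0r normrN gtr0_norm ?divr_gt0 // ltr_pdivrMr // ltr_pMr // ltr1n.
- by rewrite divr_gt0.
- by apply: ptC => j; exact: ltnW.
- by apply: ptC => j; exact: ltnW.
have [y yx] := cell i; rewrite (iP (pt y)) ?eqxx //.
apply: le_lt_trans hd; apply/mx_norm_le; first exact: ltW.
move=> i' j; rewrite !mxE.
have /andP[xy yx1] := yx j.
have -> : - e + 2 * e / k%:R * (x j)%:R - (- e + 2 * e / k%:R * (y j)%:R) =
  - (2 * e / k%:R * ((y j)%:R - (x j)%:R)) by ring.
rewrite normrN -natrB // normrM gtr0_norm // normr_nat ger_pMr // lern1.
by rewrite leq_subLR addn1.
Unshelve. all: by end_near. Qed.
End Cube.

(** * Moving a map off a point *)

Section Dimension.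
Context {R : realType}.

Definition lipschitz (V W : normedModType R) (L : R) (f : V -> W) :=
  forall x y, `|f x - f y| <= L * `|x - y|.

Lemma lipschitz_cts (V W : normedModType R) L (f : V -> W) : 0 < L ->
  lipschitz L f -> continuous f.
Proof.
move=> L0 fL x; apply/cvgrPdist_lt => eps eps0.
near=> y; rewrite (le_lt_trans (fL _ _)) // mulrC -ltr_pdivlMr //.
by near: y; apply: (@cvgr_dist_lt _ _ _ (nbhs x) _ id) => //; rewrite divr_gt0.
Unshelve. all: by end_near. Qed.

(** Each coordinate of f is replaced by its inf-convolution with the cone
L |x - y|. The constant L = 2 M / d, where M bounds f and d is a modulus of
uniform continuity for eta, makes the points at distance at least d from x
irrelevant to the infimum at x. *)
Lemma lipschitz_approx (V : normedModType R) n (K : set V)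
    (f : V -> 'rV[R]_n) (eta : R) :
  compact K -> K !=set0 -> (forall x, K x -> {for x, continuous f}) -> 0 < eta ->
  exists L (g : V -> 'rV[R]_n),
    [/\ 0 < L, lipschitz L g & forall x, K x -> `|f x - g x| <= eta].
Proof.
move=> cK [x0 Kx0] fc eta0.
have [d d0 fd] := uniformly_continuous cK fc eta0.
have [M M0 fM] : exists2 M : R, 0 < M & forall x, K x -> `|f x| <= M.
  have /compact_bounded[M [_ MP]] : compact [set f x | x in K].
    apply: continuous_compact => //; apply/subspace_continuousP => x Kx.
    exact: cvg_within_filter (fc x Kx).
  exists (`|M| + 1); first by rewrite ltr_wpDl.
  move=> x Kx; apply: (MP (`|M| + 1)); last by exists x.
  by rewrite (le_lt_trans (ler_norm _)) // ltrDl.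
pose L := 2 * M / d.
have L0 : 0 < L by rewrite divr_gt0 // mulr_gt0.
pose S j (x : V) := [set f y ord0 j + L * `|x - y| | y in K].
have SM (j : 'I_n) x : lbound (S j x) (- M).
  move=> _ [y Ky <-]; have := coord_norm (f y) ord0 j.
  have := fM _ Ky; have : 0 <= L * `|x - y| by rewrite mulr_ge0 // ltW.
  by move=> ? ? ?; have := lerNnormlW (le_refl `|f y ord0 j|); lra.
have infS (j : 'I_n) x y : K y -> inf (S j x) <= f y ord0 j + L * `|x - y|.
  by move=> Ky; apply: ge_inf; [exists (- M); exact: SM|exists y].
pose g x := \row_j inf (S j x) : 'rV[R]_n.
exists L, g; split => //.
  have half (j : 'I_n) x y : inf (S j x) <= inf (S j y) + L * `|x - y|.
    rewrite -lerBlDr; apply: lb_le_inf; first by exists (f x0 ord0 j + L * `|y - x0|), x0.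
    move=> _ [z Kz <-]; rewrite lerBlDr.
    apply: (le_trans (infS _ _ z Kz)); rewrite -addrA lerD2l -mulrDr ler_pM2l //.
    by rewrite [leRHS]addrC ler_distD.
  move=> x y; apply/mx_norm_le; first by rewrite mulr_ge0 // ltW.
  move=> i j; rewrite !mxE ler_distl; apply/andP; split; last exact: half.
  by rewrite lerBlDr distrC; exact: half.
move=> x Kx; apply/mx_norm_le; first exact: ltW.
move=> i j; rewrite (ord1 i) !mxE ler_distl; apply/andP; split.
  by have := infS j x x Kx; rewrite subrr normr0 mulr0; lra.
rewrite -lerBlDr; apply: lb_le_inf; first by exists (f x0 ord0 j + L * `|x - x0|), x0.
move=> _ [y Ky <-]; have [xy|xy] := ltP `|x - y| d.
  have := fd _ _ Kx xy => /ltW/(mx_norm_le _ (ltW eta0)).1 /(_ ord0 j).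
  rewrite !mxE ler_distl => /andP[_ ?]; have : 0 <= L * `|x - y| by rewrite mulr_ge0 // ltW.
  by lra.
have : 2 * M <= L * `|x - y| by rewrite -(divfK (lt0r_neq0 d0) (2 * M)) ler_pM2l.
have := le_trans (coord_norm (f y) ord0 j) (fM _ Ky).
have := le_trans (coord_norm (f x) ord0 j) (fM _ Kx).
by rewrite !ler_norml => /andP[? ?] /andP[? ?] ?; lra.
Qed.

(** Counting: cut the m-cube into (N + 1)^m cells of mesh 2 e / N, with N = K M,
the last cell on each side being degenerate. The image of a cell has diameter
less than c / M, so it contains at most one of the M^n points of a grid of mesh
c / M. Since m < n, there are
more grid points than cells when M is large, so some grid point is missed. *)
Lemma lipschitz_misses m n (g : 'rV[R]_m -> 'rV[R]_n) (L e c : R) :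
  (m < n)%N -> 0 < L -> 0 < e -> 0 < c -> lipschitz L g ->
  exists2 p : 'rV[R]_n, `|p| <= c & forall x, `|x| <= e -> g x != p.
Proof.
move=> mn L0 e0 c0 gL; apply: contrapT => all_hit.
pose K := (Num.truncn (2 * L * e / c)).+1.
(* M exceeds K.+1 ^ m, whence (N + 1) ^ m <= (K.+1 * M) ^ m < M ^ m.+1 *)
pose M := ((K.+1 ^ m).+1)%N.
pose N := (K * M)%N.
have K0 : 0 < K%:R :> R by rewrite ltr0n.
have M0 : 0 < M%:R :> R by rewrite ltr0n.
have N0 : 0 < N%:R :> R by rewrite natrM mulr_gt0.
pose p (t : {ffun 'I_n -> 'I_M}) : 'rV[R]_n := \row_j (c / M%:R * (t j : nat)%:R).
have hit t : exists x, `|x| <= e /\ g x = p t.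
  apply: contrapT => nohit; apply: all_hit; exists (p t).
    apply/mx_norm_le; first exact: ltW.
    move=> i j; rewrite mxE ger0_norm; last by rewrite mulr_ge0 // divr_ge0 // ltW.
    rewrite mulrAC ler_pdivrMr // ler_pM2l // ler_nat; exact/ltnW/ltn_ord.
  by move=> x xe; apply/eqP => gx; apply: nohit; exists x.
have [x xP] := choice hit.
(* the j-th coordinate of x t, rescaled from [-e, e] to [0, N] *)
pose scaled t j := (x t ord0 j + e) / (2 * e) * N%:R.
have scaled_ge0 t j : 0 <= scaled t j.
  have := le_trans (coord_norm (x t) ord0 j) (xP t).1.
  by rewrite ler_norml => /andP[? ?]; rewrite mulr_ge0 ?divr_ge0 //; lra.
have scaled_le t j : scaled t j <= N%:R.
  have := le_trans (coord_norm (x t) ord0 j) (xP t).1.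
  rewrite ler_norml => /andP[? ?]; rewrite ger_pMl // ler_pdivrMr; last lra.
  by rewrite mul1r; lra.
pose cell t : {ffun 'I_m -> 'I_N.+1} := [ffun j => inord (Num.truncn (scaled t j))].
have /leq_card : injective cell.
  move=> t s ts; apply/ffunP => j; apply: ord_inj.
  have near_x : `|x t - x s| <= 2 * e / N%:R.
    apply/mx_norm_le; first by rewrite divr_ge0 // ?ltW // mulr_gt0.
    move=> i k; rewrite (ord1 i) !mxE.
    have tr r : (inord (Num.truncn (scaled r k)) : 'I_N.+1) = Num.truncn (scaled r k) :> nat.
      rewrite inordK // ltnS -(ler_nat R); apply: le_trans (scaled_le r k).
      by rewrite truncn_le.
    have /(congr1 (@nat_of_ord _)) := congr1 (fun f : {ffun _} => f k) ts.
    rewrite !ffunE !tr => teq.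
    have /andP[] := truncn_itv (scaled_ge0 t k).
    have /andP[] := truncn_itv (scaled_ge0 s k); rewrite teq -natr1 => ? ? ? ?.
    have : `|scaled t k - scaled s k| <= 1.
      by rewrite ler_distl; apply/andP; split; lra.
    have -> : scaled t k - scaled s k = (x t ord0 k - x s ord0 k) * (N%:R / (2 * e)).
      by rewrite /scaled; field; rewrite gt_eqF.
    rewrite normrM [`|N%:R / _|]gtr0_norm ?divr_gt0 ?mulr_gt0 //.
    by rewrite -ler_pdivlMr ?divr_gt0 ?mulr_gt0 // invf_div mul1r.
  have : `|p t - p s| < c / M%:R.
    rewrite -(xP t).2 -(xP s).2; apply: le_lt_trans (gL _ _) _.
    apply: (@le_lt_trans _ _ (L * (2 * e / N%:R))); first by rewrite ler_pM2l.
    have : 2 * L * e / c < K%:R by exact: truncnS_gt.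
    rewrite ltr_pdivrMr // => h; rewrite ltr_pdivlMr // natrM.
    have -> : L * (2 * e / (K%:R * M%:R)) * M%:R = 2 * L * e / K%:R.
      by field; rewrite !gt_eqF.
    by rewrite ltr_pdivrMr // [c * _]mulrC.
  move/(mx_norm_lt _ (divr_gt0 c0 M0)).1/(_ ord0 j).
  rewrite !mxE -mulrBr normrM gtr0_norm ?divr_gt0 // gtr_pMr ?divr_gt0 //.
  rewrite ltr_norml => /andP[].
  move: (nat_of_ord (t j)) (nat_of_ord (s j)) => tj sj.
  by case: (ltngtP tj sj) => //; rewrite -(ler_nat R) -natr1 => ? ? ?; exfalso; lra.
rewrite !card_ffun !card_ord => le_card.
suff : (N.+1 ^ m < M ^ n)%N by rewrite ltnNge le_card.
apply: (@leq_ltn_trans ((K.+1 * M) ^ m)).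
  case: (posnP m) => [->|m0]; first by rewrite !expn0.
  by rewrite leq_exp2r // mulSn -add1n leq_add2r.
rewrite expnMn; apply: (@leq_trans (M ^ m.+1)); last exact: leq_pexp2l.
by rewrite expnS ltn_pmul2r // expn_gt0.
Qed.

End Dimension.

Section StableSection.
Context {R : realType}.
(** If m < n, a small perturbation h of a misses the origin on a cube. By
uniform continuity b o h is close to b o a, the identity, and therefore has
opposite signs on opposite faces of the cube; it vanishes somewhere, although b
vanishes only at the origin. *)
Theorem stable_section_dim m n (a : 'rV[R]_m -> 'rV[R]_n) (b : 'rV[R]_n -> 'rV[R]_m) :
  (\forall x \near (0 : 'rV[R]_m), continuous_at x a) ->
  (\forall y \near (0 : 'rV[R]_n), continuous_at y b) ->
  (\forall x \near (0 : 'rV[R]_m), b (a x) = x) ->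
  a 0 = 0 -> (\forall y \near (0 : 'rV[R]_n), b y = 0 -> y = 0) -> (n <= m)%N.
Proof.
move=> a_cts b_cts ab a0 b0; rewrite leqNgt; apply/negP => mn.
have [r r0 rP] : exists2 r : R, 0 < r &
    forall y, `|y| < r -> continuous_at y b /\ (b y = 0 -> y = 0).
  have [r r0 rP] := (nbhs_ballP _ _).1 (filterI b_cts b0).
  by exists r => // y yr; apply: rP; rewrite -ball_normE /= sub0r normrN.
have r2 : 0 < r / 2 by rewrite divr_gt0.
have ar : \forall x \near (0 : 'rV[R]_m), `|a x| < r / 2.
  have /cvgrPdist_lt/(_ _ r2) := nbhs_singleton a_cts.
  by apply: filterS => x; rewrite a0 sub0r normrN.
have [e e0 eP] : exists2 e : R, 0 < e &
    forall x, `|x| <= e -> [/\ continuous_at x a, b (a x) = x & `|a x| < r / 2].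
  have [e e0 eP] := (nbhs_ballP _ _).1 (filterI a_cts (filterI ab ar)).
  exists (e / 2) => [|x xe]; first exact: divr_gt0.
  have xe2 : ball 0 e x.
    rewrite -ball_normE /= sub0r normrN (le_lt_trans xe) //.
    by rewrite ltr_pdivrMr // ltr_pMr // ltr1n.
  by have [? [? ?]] := eP x xe2.
pose C := [set x : 'rV[R]_m | `|x| <= e].
have cC : compact C := @compact_cube R m e.
have C0 : C !=set0 by exists 0; rewrite /C /= normr0 ltW.
have aC x : C x -> {for x, continuous a} by case/eP.
have caC : compact [set a x | x in C].
  apply: continuous_compact => //; apply/subspace_continuousP => x Cx.
  exact: cvg_within_filter (aC x Cx).
have [d d0 dP] : exists2 d : R, 0 < d &
    forall x y, C x -> `|a x - y| < d -> `|x - b y| < e.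
  have [|d d0 dP] := uniformly_continuous caC _ e0 (f := b).
    by move=> _ [x Cx <-]; apply: (rP _ _).1; have [_ _ ?] := eP x Cx; lra.
  exists d => // x y Cx xy; have [_ abx _] := eP x Cx.
  by rewrite -[x in `|x - _|]abx; apply: dP => //; exists x.
pose s := Num.min d r / 6.
have s0 : 0 < s by rewrite divr_gt0 // lt_min d0 r0.
have sd : 3 * s < d.
  have : Num.min d r <= d by rewrite ge_min lexx.
  by rewrite /s; lra.
have sr : 3 * s <= r / 2.
  have : Num.min d r <= r by rewrite ge_min lexx orbT.
  by rewrite /s; lra.
have [L [g [L0 gL ga]]] := lipschitz_approx cC C0 aC s0.
have [p ps gp] := lipschitz_misses mn L0 e0 s0 gL.
pose h x := g x - p.
have ha x : C x -> `|a x - h x| <= 2 * s.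
  move=> Cx; rewrite /h opprB addrCA [p + _]addrC.
  by rewrite (le_trans (ler_normD _ _)) // (_ : 2 * s = s + s) ?lerD ?ga //; ring.
have hr x : C x -> `|h x| < r.
  move=> Cx; have [_ _ ax] := eP x Cx; have := ha x Cx.
  have := ler_distD (a x) (h x) 0; rewrite !subr0 distrC => ? ?; lra.
have [x Cx /(rP _ (hr _ _)).2] : exists2 x, C x & b (h x) = 0; last first.
  move=> /(_ Cx) /eqP; rewrite subr_eq0 => gxp.
  by have := gp x Cx; rewrite gxp.
have close x : C x -> `|x - b (h x)| < e.
  by move=> Cx; apply: dP => //; have := ha x Cx; lra.
apply: (poincare_miranda e0) => [x Cx|x i Cx xi|x i Cx xi].
- apply: continuous_comp; last by apply: (rP _ (hr _ Cx)).1.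
  by apply: continuousB; [exact: (lipschitz_cts L0 gL)|exact: cst_continuous].
- have := (mx_norm_lt _ e0).1 (close x Cx) ord0 i.
  by rewrite !mxE xi ltr_norml => /andP[? ?]; lra.
- have := (mx_norm_lt _ e0).1 (close x Cx) ord0 i.
  by rewrite !mxE xi ltr_norml => /andP[? ?]; lra.
Qed.
End StableSection.

(** * Calculus of smooth functions *)

Section SmoothCalculus.
Context {R : realType} {V : normedModType R}.
Implicit Types (U : set V) (k : nat).

Lemma near_diff (W : normedModType R) (f g : V -> W) x :
  (\forall y \near x, f y = g y) -> differentiable f x ->
  differentiable g x /\ 'd g x = 'd f x :> (V -> W).
Proof.
move=> fg df; have [cdf _] := (diff_locallyP x f).1 df.
have dg : g \o shift x = cst (g x) + 'd f x +o_ (nbhs (0 : V)) id.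
  apply/eqaddoP => eps eps0.
  have /eqaddoP/(_ _ eps0) := ((diff_locallyP x f).1 df).2.
  have fg0 : \forall h \near (0 : V), f (h + x) = g (h + x).
    by move: fg; rewrite (near_shift 0 x) subr0.
  apply: filterS2 fg0 => h fgh /=.
  by rewrite !fctE /= fgh (nbhs_singleton fg).
have dE := diff_unique cdf dg.
split; last exact: dE.
by apply/diff_locallyP; rewrite dE; exact: (conj cdf dg).
Qed.

(** Formulas for differentials hold on U only, and it is this lemma that allows
their use inside the recursion defining [class_C]. *)
Lemma eq_class_C (W : normedModType R) k U (f g : V -> W) : open U ->
  (forall x, U x -> f x = g x) -> class_C k U f -> class_C k U g.
Proof.
move=> oU; elim: k f g => [|k IH] f g fg /=.
  move=> fc x Ux; have fgx : \forall y \near x, f y = g y.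
    by apply: filterS (open_nbhs_nbhs (conj oU Ux)).
  by rewrite /prop_for /continuous_at -fg //; apply: cvg_trans (fc x Ux); exact: near_eq_cvg.
case=> df cf.
have dfg x : U x -> differentiable g x /\ 'd g x = 'd f x :> (V -> W).
  move=> Ux; apply: near_diff (df x Ux).
  by apply: filterS (open_nbhs_nbhs (conj oU Ux)).
split=> [x /dfg[]//|v]; apply: IH (cf v) => x Ux.
exact: (esym (congr1 (fun h => h v) (dfg x Ux).2)).
Qed.

Lemma class_CS (W : normedModType R) k U (f : V -> W) :
  class_C k.+1 U f -> class_C k U f.
Proof.
elim: k f => [|k IH] f [df cf].
  by move=> x /df /differentiable_continuous.
by split=> // v; apply: IH.
Qed.

Lemma class_C_cst (W : normedModType R) k U (w : W) : class_C k U (fun=> w).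
Proof.
elim: k w => [|k IH] w; first by move=> x _; exact: cst_continuous.
split=> [x _|v]; first exact: differentiable_cst.
by rewrite (_ : (fun x => _) = fun=> 0); [exact: IH|apply/funext => x; rewrite diff_cst].
Qed.

Lemma class_C_linear (W : normedModType R) k U (f : {linear V -> W}) :
  continuous f -> class_C k U f.
Proof.
move=> cf; case: k => [|k]; first by move=> x _; exact: cf.
split=> [x _|v]; first exact: linear_differentiable.
rewrite (_ : (fun x => _) = fun=> f v); first exact: class_C_cst.
by apply/funext => x; rewrite diff_lin.
Qed.

Lemma class_CD (W : normedModType R) k U (f g : V -> W) : open U ->
  class_C k U f -> class_C k U g -> class_C k U (fun x => f x + g x).
Proof.
move=> oU; elim: k f g => [|k IH] f g.
  by move=> cf cg x Ux; apply: continuousD; [exact: cf|exact: cg].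
move=> [df cf] [dg cg]; split=> [x Ux|v].
  by apply: differentiableD; [exact: df|exact: dg].
apply: (@eq_class_C _ _ _ (fun x => 'd f x v + 'd g x v)) => //; last exact: IH (cf v) (cg v).
by move=> x Ux; exact: (esym (congr1 (fun h => h v) (diffD (df x Ux) (dg x Ux)))).
Qed.

Lemma class_CM k U (f g : V -> R) : open U ->
  class_C k U f -> class_C k U g -> class_C k U (fun x => f x * g x).
Proof.
move=> oU; elim: k f g => [|k IH] f g.
  by move=> cf cg x Ux; apply: continuousM; [exact: cf|exact: cg].
move=> cf1 cg1; have [df cf] := cf1; have [dg cg] := cg1.
split=> [x Ux|v]; first by apply: differentiableM; [exact: df|exact: dg].
apply: (@eq_class_C _ _ _ (fun x => f x * 'd g x v + g x * 'd f x v)) => //.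
  by move=> x Ux; exact: (esym (congr1 (fun h => h v) (diffM (df x Ux) (dg x Ux)))).
apply: class_CD => //; first exact: IH (class_CS cf1) (cg v).
exact: IH (class_CS cg1) (cf v).
Qed.

(** The differential of 1 / f is expressed through 1 / f itself, so the induction
on k feeds on its own conclusion; the same happens for the square root. *)
Lemma class_CV k U (f : V -> R) : open U -> (forall x, U x -> f x != 0) ->
  class_C k U f -> class_C k U (fun x => (f x)^-1).
Proof.
move=> oU f0; elim: k => [|k IH] cf1.
  by move=> x Ux; apply: cvgV; [exact: f0|exact: cf1].
have cVf : class_C k U (fun x => (f x)^-1) by apply: IH; exact: class_CS.
have [df cf] := cf1; split=> [x Ux|v].
  by apply: differentiableV; [exact: df|exact: f0].
apply: (@eq_class_C _ _ _ (fun x => (-1 * ((f x)^-1 * (f x)^-1)) * 'd f x v)) => //.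
  move=> x Ux; rewrite diffV; [|exact: df|exact: f0].
  by rewrite /= mulN1r -invfM -expr2.
apply: class_CM => //; last exact: cf v.
by apply: class_CM => //; [exact: class_C_cst|exact: class_CM].
Qed.

Lemma class_C_sqrt k U (f : V -> R) : open U -> (forall x, U x -> 0 < f x) ->
  class_C k U f -> class_C k U (fun x => Num.sqrt (f x)).
Proof.
move=> oU f0; elim: k => [|k IH] cf1.
  move=> x Ux; apply: (@continuous_comp _ _ _ f); first exact: cf1.
  exact: sqrt_continuous.
have cVf : class_C k U (fun x => Num.sqrt (f x)) by apply: IH; exact: class_CS.
have [df cf] := cf1.
have dsqrt (x : R) : 0 < x -> differentiable (Num.sqrt : R -> R) x /\
    'd (Num.sqrt : R -> R) x = (fun h => h * (2 * Num.sqrt x)^-1) :> (R -> R).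
  move=> x0; have dx : derivable (Num.sqrt : R -> R) x 1.
    by have [] := is_derive1_sqrt x0.
  split; first exact/derivable1_diffP.
  rewrite diff1E; last exact/derivable1_diffP.
  apply/funext => h; congr (h *: _).
  by rewrite derive1E; have [_ ->] := is_derive1_sqrt x0.
split=> [x Ux|v].
  by apply: differentiable_comp; [exact: df|exact: (dsqrt _ (f0 _ Ux)).1].
apply: (@eq_class_C _ _ _ (fun x => 'd f x v * (2 * Num.sqrt (f x))^-1)) => //.
  move=> x Ux; have [d1 d2] := dsqrt _ (f0 _ Ux).
  exact: (esym (etrans (congr1 (fun h => h v) (diff_comp (df x Ux) d1))
    (congr1 (fun h => h ('d f x v)) d2))).
apply: class_CM => //; first exact: cf v.
apply: class_CV => //.
  by move=> x Ux; rewrite mulf_neq0 // ?pnatr_eq0 // gt_eqF // sqrtr_gt0 f0.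
by apply: class_CM => //; exact: class_C_cst.
Qed.

Lemma class_C_scalel (W : normedModType R) k U (f : V -> R) (w : W) : open U ->
  class_C k U f -> class_C k U (fun x => f x *: w).
Proof.
move=> oU; elim: k f => [|k IH] f.
  by move=> cf x Ux; apply: cvgZr_tmp; exact: cf.
move=> [df cf]; split=> [x Ux|v].
  by apply: differentiableZl; exact: df.
apply: (@eq_class_C _ _ _ (fun x => 'd f x v *: w)) => //; last exact: IH (cf v).
by move=> x Ux; rewrite diffZl //; exact: df.
Qed.

Definition smooth (W : normedModType R) U (f : V -> W) := forall k, class_C k U f.

Lemma smooth_cst (W : normedModType R) U (w : W) : smooth U (fun=> w).
Proof. by move=> k; exact: class_C_cst. Qed.

Lemma smoothD (W : normedModType R) U (f g : V -> W) : open U ->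
  smooth U f -> smooth U g -> smooth U (fun x => f x + g x).
Proof. by move=> oU sf sg k; apply: class_CD. Qed.

Lemma smooth_sum (W : normedModType R) U (I : Type) (r : seq I) (F : I -> V -> W) :
  open U -> (forall i, smooth U (F i)) -> smooth U (fun x => \sum_(i <- r) F i x).
Proof.
move=> oU sF; elim: r => [|i r IH].
  by under eq_fun => x do rewrite big_nil; exact: smooth_cst.
by under eq_fun => x do rewrite big_cons; exact: smoothD.
Qed.

Lemma smoothM U (f g : V -> R) : open U ->
  smooth U f -> smooth U g -> smooth U (fun x => f x * g x).
Proof. by move=> oU sf sg k; apply: class_CM. Qed.

Lemma smoothN U (f : V -> R) : open U ->
  smooth U f -> smooth U (fun x => - f x).
Proof.
move=> oU sf; under eq_fun => x do rewrite -mulN1r.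
by apply: smoothM => //; exact: smooth_cst.
Qed.

Lemma smoothB U (f g : V -> R) : open U ->
  smooth U f -> smooth U g -> smooth U (fun x => f x - g x).
Proof. by move=> oU sf sg; apply: smoothD => //; exact: smoothN. Qed.

Lemma smoothX U (f : V -> R) n : open U ->
  smooth U f -> smooth U (fun x => f x ^+ n).
Proof.
move=> oU sf; elim: n => [|n IH]; first exact: smooth_cst.
by under eq_fun => x do rewrite exprS; exact: smoothM.
Qed.

Lemma smooth_div U (f g : V -> R) : open U -> (forall x, U x -> g x != 0) ->
  smooth U f -> smooth U g -> smooth U (fun x => f x / g x).
Proof.
by move=> oU g0 sf sg; apply: smoothM => // k; apply: class_CV.
Qed.

Lemma smooth_sqrt U (f : V -> R) : open U -> (forall x, U x -> 0 < f x) ->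
  smooth U f -> smooth U (fun x => Num.sqrt (f x)).
Proof. by move=> oU f0 sf k; apply: class_C_sqrt. Qed.

Lemma smooth_mx U m n (F : V -> 'M[R]_(m, n)) : open U ->
  (forall i j, smooth U (fun x => F x i j)) -> smooth U F.
Proof.
move=> oU sF.
have -> : F = fun x => \sum_(i < m) \sum_(j < n) F x i j *: delta_mx i j.
  by apply/funext => x; exact: matrix_sum_delta.
apply: smooth_sum => // i; apply: smooth_sum => // j k.
by apply: class_C_scalel => //; exact: sF.
Qed.

Lemma smooth_mulmx U m n p (F : V -> 'M[R]_(m, n)) (G : V -> 'M[R]_(n, p)) i j :
  open U -> (forall i j, smooth U (fun x => F x i j)) ->
  (forall i j, smooth U (fun x => G x i j)) ->
  smooth U (fun x => (F x *m G x) i j).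
Proof.
move=> oU sF sG; under eq_fun => x do rewrite mxE.
by apply: smooth_sum => // l; exact: smoothM.
Qed.

Lemma smooth_continuous (W : normedModType R) U (f : V -> W) x :
  smooth U f -> U x -> continuous_at x f.
Proof. by move=> sf; exact: (sf 0%N). Qed.

Lemma smooth_on_open (W : normedModType R) (X U : set V) (f : V -> W) :
  open U -> X `<=` U -> smooth U f -> smooth_on X f.
Proof. by move=> oU XU sf x Xx; exists U, f; split => //; exact: XU. Qed.

End SmoothCalculus.

Lemma smooth_coord {R : realType} m n (U : set 'M[R]_(m, n)) i j :
  smooth U (fun A : 'M[R]_(m, n) => A i j).
Proof.
move=> k; have lin : linear (fun A : 'M[R]_(m, n) => A i j : R^o).
  by move=> a A B; rewrite !mxE.
pose f : {linear 'M[R]_(m, n) -> R^o} := HB.pack (fun A : 'M[R]_(m, n) => A i j : R^o)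
  (GRing.isLinear.Build _ _ _ _ _ lin).
by apply: (@class_C_linear _ _ _ k U f); exact: coord_continuous.
Qed.

(** * Matrices of order three on the sphere *)

Section ThreeByThree.
Context {R : realType}.
Implicit Types (A B C L M : 'M[R]_3).

Definition i0 : 'I_3 := ord0.
Definition i1 : 'I_3 := lift ord0 ord0.
Definition i2 : 'I_3 := lift ord0 (lift ord0 ord0).

Lemma I3P (P : 'I_3 -> Prop) : P i0 -> P i1 -> P i2 -> forall i, P i.
Proof.
move=> p0 p1 p2 [[|[|[|//]]] lti].
- by rewrite (_ : Ordinal lti = i0) //; exact: val_inj.
- by rewrite (_ : Ordinal lti = i1) //; exact: val_inj.
- by rewrite (_ : Ordinal lti = i2) //; exact: val_inj.
Qed.

Lemma sum3 (F : 'I_3 -> R) : \sum_i F i = F i0 + F i1 + F i2.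
Proof. by rewrite !big_ord_recl big_ord0 addr0 addrA. Qed.

Lemma det3 M : \det M =
  M i0 i0 * (M i1 i1 * M i2 i2 - M i1 i2 * M i2 i1)
  - M i0 i1 * (M i1 i0 * M i2 i2 - M i1 i2 * M i2 i0)
  + M i0 i2 * (M i1 i0 * M i2 i1 - M i1 i1 * M i2 i0).
Proof.
have [F MF] : exists F : nat -> nat -> R, forall i j, M i j = F i j.
  by exists (fun i j => M (inord i) (inord j)) => i j; rewrite !inord_val.
rewrite (expand_det_row _ i0) sum3 /cofactor !(expand_det_row _ (ord0 : 'I_2)).
rewrite !big_ord_recl !big_ord0 /cofactor !det_mx11 !mxE !MF /= /bump /=.
by rewrite !(addn0, add0n, addn1, add1n, expr0, expr1, sqrrN); ring.
Qed.

Definition mx3 (a00 a01 a02 a10 a11 a12 a20 a21 a22 : R) : 'M[R]_3 :=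
  \matrix_(i, j) nth 0 (nth [::]
    [:: [:: a00; a01; a02]; [:: a10; a11; a12]; [:: a20; a21; a22]] i) j.

Lemma mx3_eq M M' :
  M i0 i0 = M' i0 i0 -> M i0 i1 = M' i0 i1 -> M i0 i2 = M' i0 i2 ->
  M i1 i0 = M' i1 i0 -> M i1 i1 = M' i1 i1 -> M i1 i2 = M' i1 i2 ->
  M i2 i0 = M' i2 i0 -> M i2 i1 = M' i2 i1 -> M i2 i2 = M' i2 i2 -> M = M'.
Proof.
move=> ? ? ? ? ? ? ? ? ?; apply/matrixP.
by elim/I3P; elim/I3P.
Qed.

Definition sqnorm M : R := \sum_i \sum_j M i j ^+ 2.

Lemma sqnorm_ge0 M : 0 <= sqnorm M.
Proof. by apply: sumr_ge0 => i _; apply: sumr_ge0 => j _; exact: sqr_ge0. Qed.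

Lemma sqnorm_eq0 M : sqnorm M = 0 -> M = 0.
Proof.
move=> M0; apply/matrixP => i j; rewrite mxE; apply/eqP; rewrite -sqrf_eq0.
have M0i : \sum_j M i j ^+ 2 = 0.
  apply/eqP; move/eqP: M0; rewrite psumr_eq0 => [/allP/(_ i)|k _].
    by rewrite mem_index_enum; apply.
  by apply: sumr_ge0 => l _; exact: sqr_ge0.
move/eqP: M0i; rewrite psumr_eq0 => [/allP/(_ j)|k _]; last exact: sqr_ge0.
by rewrite mem_index_enum; apply.
Qed.

Lemma sqnorm_gt0 M : M != 0 -> 0 < sqnorm M.
Proof.
rewrite lt0r sqnorm_ge0 andbT; apply: contra => /eqP M0.
by apply/eqP; exact: sqnorm_eq0.
Qed.

Lemma sqnormZ a M : sqnorm (a *: M) = a ^+ 2 * sqnorm M.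
Proof.
rewrite /sqnorm mulr_sumr; apply: eq_bigr => i _; rewrite mulr_sumr.
by apply: eq_bigr => j _; rewrite mxE exprMn.
Qed.

Lemma S8E M : S8 M <-> sqnorm M = 3.
Proof.
rewrite /S8 /euclidean_norm /= -/(sqnorm M); split => [|->//].
move/(congr1 (fun x => x ^+ 2)); rewrite !sqr_sqrtr //; exact: sqnorm_ge0.
Qed.

Lemma V7E M : V7 M <-> S8 M /\ \det M = 0.
Proof.
rewrite S8E /V7 /= /euclidean_norm -/(sqnorm M) sqr_sqrtr //.
exact: sqnorm_ge0.
Qed.

Definition to_sphere M : 'M[R]_3 := (Num.sqrt 3 / Num.sqrt (sqnorm M)) *: M.

Lemma to_sphere_S8 M : M != 0 -> S8 (to_sphere M).
Proof.
move=> /sqnorm_gt0 M0; apply/S8E; rewrite sqnormZ expr_div_n !sqr_sqrtr //.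
  by rewrite divfK // gt_eqF.
exact: ltW.
Qed.

Lemma to_sphereZ a M : 0 < a -> S8 (a *: M) -> to_sphere M = a *: M.
Proof.
move=> a0 /S8E; rewrite sqnormZ => aM; congr (_ *: _).
have M0 : 0 < sqnorm M.
  by rewrite -(pmulr_rgt0 _ (exprn_gt0 2 a0)) aM.
rewrite -aM sqrtrM ?sqr_ge0 // sqrtr_sqr gtr0_norm // mulfK //.
by rewrite gt_eqF // sqrtr_gt0.
Qed.

Lemma smooth_to_sphere (V : normedModType R) (U : set V) (F : V -> 'M[R]_3) :
  open U -> (forall x, U x -> F x != 0) ->
  (forall i j, smooth U (fun x => F x i j)) ->
  smooth U (fun x => to_sphere (F x)).
Proof.
move=> oU F0 sF; apply: smooth_mx => // i j.
under eq_fun => x do rewrite mxE.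
have sN : smooth U (fun x => sqnorm (F x)).
  by apply: smooth_sum => // ?; apply: smooth_sum => // ?; exact: smoothX.
apply: smoothM => //; apply: smooth_div => //.
- by move=> x Ux; rewrite gt_eqF // sqrtr_gt0 sqnorm_gt0 // F0.
- exact: smooth_cst.
- by apply: smooth_sqrt => // x Ux; rewrite sqnorm_gt0 // F0.
Qed.

(** * A slice chart along the singular matrices *)

Section SliceChart.
Variables (L M : 'M[R]_3).
Hypotheses (uL : L \in unitmx) (uM : M \in unitmx).

Definition frame (B : 'M[R]_3) : 'M[R]_3 := invmx L *m B *m invmx M.

Lemma frameK B : L *m frame B *m M = B.
Proof. by rewrite /frame !mulmxA mulmxV // mul1mx mulmxKV. Qed.

Lemma frame_mul C : frame (L *m C *m M) = C.
Proof. by rewrite /frame !mulmxA mulVmx // mul1mx mulmxK. Qed.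

Lemma frameZ a B : frame (a *: B) = a *: frame B.
Proof. by rewrite /frame -scalemxAr -scalemxAl. Qed.

Lemma smooth_frame U i j : open U -> smooth U (fun B => frame B i j).
Proof.
move=> oU; apply: smooth_mulmx => // k l; last exact: smooth_cst.
apply: smooth_mulmx => // p q; first exact: smooth_cst.
exact: smooth_coord.
Qed.

Lemma det_frame_eq0 B : (\det (frame B) = 0) <-> (\det B = 0).
Proof.
have det_inv_neq0 (A : 'M[R]_3) : A \in unitmx -> \det (invmx A) != 0.
  by rewrite det_inv invr_eq0 unitmxE unitfE.
rewrite /frame !det_mulmx; split => [/eqP|->]; last by rewrite mulr0 mul0r.
by rewrite !mulf_eq0 !(negPf (det_inv_neq0 _ _)) // orbF => /eqP.
Qed.

Lemma frame_neq0 C : C != 0 -> L *m C *m M != 0.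
Proof.
by apply: contra => /eqP C0; rewrite -(frame_mul C) C0 /frame mulmx0 mul0mx.
Qed.

(** The second condition is the positivity of the leading 2 x 2 minor. Both
conditions are open and invariant under positive scaling. *)
Definition chart_dom : set 'M[R]_3 := [set B |
  0 < frame B i0 i0 /\
  0 < frame B i0 i0 * frame B i1 i1 - frame B i0 i1 * frame B i1 i0].

(** Homogeneous coordinates with C00 scaled to 1; the determinant takes the place
of the last entry. *)
Definition chart (B : 'M[R]_3) : 'rV[R]_8 :=
  let c := frame B in
  \row_(i < 8) nth 0 [:: c i0 i1 / c i0 i0; c i0 i2 / c i0 i0;
    c i1 i0 / c i0 i0; c i1 i1 / c i0 i0; c i1 i2 / c i0 i0;
    c i2 i0 / c i0 i0; c i2 i1 / c i0 i0; \det c / c i0 i0 ^+ 3] i.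

Local Notation "y '_[' k ]" := (y (ord0 : 'I_1) (@Ordinal 8 k isT)) (at level 3).

Definition chart_img : set 'rV[R]_8 :=
  [set y | 0 < y _[3] - y _[0] * y _[2]].

(** The solution z of the affine equation saying that the matrix [affine_mx]
with last entry z has determinant y_7. *)
Definition last_entry (y : 'rV[R]_8) : R :=
  (y _[7] + y _[4] * y _[6] - y _[1] * (y _[2] * y _[6] - y _[3] * y _[5])
   - y _[0] * y _[4] * y _[5]) / (y _[3] - y _[0] * y _[2]).

Definition affine_mx (y : 'rV[R]_8) : 'M[R]_3 :=
  mx3 1 y _[0] y _[1] y _[2] y _[3] y _[4] y _[5] y _[6] (last_entry y).

Definition chart_inv (y : 'rV[R]_8) : 'M[R]_3 :=
  to_sphere (L *m affine_mx y *m M).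

Lemma det_affine_mx y : chart_img y -> \det (affine_mx y) = y _[7].
Proof.
rewrite /chart_img /= => y0; rewrite det3 !mxE /= /last_entry.
by field; rewrite gt_eqF.
Qed.

Lemma affine_mx_neq0 y : affine_mx y != 0.
Proof.
apply/eqP => /matrixP/(_ i0 i0); rewrite !mxE /= => /eqP.
by rewrite oner_eq0.
Qed.

Lemma chart_invP y : chart_img y ->
  exists2 s : R, 0 < s & frame (chart_inv y) = s *: affine_mx y.
Proof.
move=> y0; exists (Num.sqrt 3 / Num.sqrt (sqnorm (L *m affine_mx y *m M))).
  by rewrite divr_gt0 // ?sqrtr_gt0 // sqnorm_gt0 // frame_neq0 ?affine_mx_neq0.
by rewrite /chart_inv frameZ frame_mul.
Qed.

Lemma chart_inv_dom y : chart_img y -> (S8 `&` chart_dom) (chart_inv y).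
Proof.
move=> y0; split.
  by apply: to_sphere_S8; rewrite frame_neq0 ?affine_mx_neq0.
have [s s0 E] := chart_invP y0; rewrite /chart_dom /= E !mxE /=.
split; first by rewrite mulr1.
have -> : s * 1 * (s * y _[3]) - s * y _[0] * (s * y _[2]) =
   s ^+ 2 * (y _[3] - y _[0] * y _[2]) by ring.
by rewrite mulr_gt0 // exprn_gt0.
Qed.

Lemma chart_invK y : chart_img y -> chart (chart_inv y) = y.
Proof.
move=> y0; have [s s0 E] := chart_invP y0; rewrite /chart E detZ det_affine_mx //.
apply/rowP => i; rewrite !mxE /=.
have s1 : s != 0 by rewrite gt_eqF.
have yE k (ltk : (k < 8)%N) : Ordinal ltk = @Ordinal 8 k ltk by [].
case: i => -[|[|[|[|[|[|[|[|//]]]]]]]] lti /=;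
  rewrite (bool_irrelevance lti isT) mulr1;
  try by rewrite mulrAC divff // mul1r.
by rewrite mulrAC divff ?expf_neq0 // mul1r.
Qed.

Lemma chart_domP B : chart_dom B ->
  chart_img (chart B) /\ frame B = frame B i0 i0 *: affine_mx (chart B).
Proof.
rewrite /chart_dom /chart /=; move: (frame B) => c [c0 m0].
have c0' : c i0 i0 != 0 by rewrite gt_eqF.
set y := \row_i _; have img : chart_img y.
  rewrite /chart_img /= !mxE /=.
  have -> : c i1 i1 / c i0 i0 -
      c i0 i1 / c i0 i0 * (c i1 i0 / c i0 i0) =
    (c i0 i0 * c i1 i1 - c i0 i1 * c i1 i0)
      / c i0 i0 ^+ 2 by field.
  by rewrite divr_gt0 // exprn_gt0.
split => //.
apply: mx3_eq; rewrite !mxE /= ?mxE /=; try by field.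
rewrite /last_entry !mxE /= det3; field.
by rewrite c0' [c i1 i1 * _]mulrC gt_eqF.
Qed.

Lemma chartK B : S8 B -> chart_dom B -> chart_inv (chart B) = B.
Proof.
move=> SB Bdom; have [_ E] := chart_domP Bdom; have [c0 _] := Bdom.
have BE : frame B i0 i0 *: (L *m affine_mx (chart B) *m M) = B.
  by rewrite scalemxAl scalemxAr -E frameK.
by rewrite /chart_inv (to_sphereZ c0) // BE.
Qed.

Lemma open_chart_dom : open chart_dom.
Proof.
have sc i j := smooth_frame i j (@openT 'M[R]_3).
apply: openI.
  apply: (@open_comp _ _ (fun B => frame B i0 i0) [set x | 0 < x]).
    by move=> B _; exact: (smooth_continuous (sc i0 i0)).
  exact: open_gt.
apply: (@open_comp _ _ (fun B => frame B i0 i0 * frame B i1 i1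
    - frame B i0 i1 * frame B i1 i0) [set x | 0 < x]); last exact: open_gt.
move=> B _; apply: (@smooth_continuous _ _ _ setT) => //.
by apply: smoothB; [exact: openT|apply: smoothM => //; exact: openT..].
Qed.

Lemma open_chart_img : open chart_img.
Proof.
apply: (@open_comp _ _ (fun y : 'rV[R]_8 => y _[3] - y _[0] * y _[2])
  [set x | 0 < x]); last exact: open_gt.
move=> B _; apply: (@smooth_continuous _ _ _ setT) => //.
apply: smoothB; [exact: openT|exact: smooth_coord|].
by apply: smoothM; [exact: openT|exact: smooth_coord..].
Qed.

Lemma smooth_chart : smooth chart_dom chart.
Proof.
have oD := open_chart_dom.
have sc i j := smooth_frame i j oD.
have c0 B : chart_dom B -> frame B i0 i0 != 0 by case=> ? _; rewrite gt_eqF.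
apply: smooth_mx => // i k; under eq_fun => B do rewrite mxE.
case: k => -[|[|[|[|[|[|[|[|//]]]]]]]] ltk /=;
  try by apply: smooth_div => //; exact: sc.
apply: smooth_div => //.
- by move=> B /c0 B0; rewrite expf_neq0.
- under eq_fun => B do rewrite det3.
  by do ?[apply: smoothD => //|apply: smoothN => //|apply: smoothM => //].
- exact: smoothX.
Qed.

Lemma smooth_chart_inv : smooth chart_img chart_inv.
Proof.
have oD := open_chart_img.
apply: smooth_to_sphere => // [y y0|i j].
  by rewrite frame_neq0 ?affine_mx_neq0.
apply: smooth_mulmx => // k l; last exact: smooth_cst.
apply: smooth_mulmx => // p q; first exact: smooth_cst.
have sy r (ltr : (r < 8)%N) : smooth chart_img (fun y : 'rV[R]_8 => y ord0 (Ordinal ltr)).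
  exact: smooth_coord.
under eq_fun => y do rewrite mxE.
have sl : smooth chart_img last_entry.
  apply: smooth_div => //.
  - by move=> y y0; rewrite gt_eqF.
  - by do ?[apply: smoothD => //|apply: smoothN => //|apply: smoothM => //].
  - by do ?[apply: smoothD => //|apply: smoothN => //|apply: smoothM => //].
case: p => -[|[|[|//]]] /= _; case: q => -[|[|[|//]]] /= _;
  by first [exact: sy|exact: sl|exact: smooth_cst].
Qed.

Lemma slice_submanifold : submanifold 8 S8 7 (V7 `&` chart_dom).
Proof.
split => // [B [/V7E[]]//|B [_ domB]].
exists chart_dom; split => //; first exact: open_chart_dom.
exists chart_img, chart, chart_inv; split; first exact: open_chart_img.
  split.
  - rewrite eqEsubset; split=> [_ [B' [SB' domB'] <-]|y y0].
      by have [] := chart_domP domB'.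
    by exists (chart_inv y); [exact: chart_inv_dom|exact: chart_invK].
  - by move=> B'; rewrite inE => -[SB' domB']; exact: chartK.
  - by apply: smooth_on_open open_chart_dom _ smooth_chart => ? [].
  - by apply: smooth_on_open open_chart_img _ smooth_chart_inv.
have detE B' : chart_dom B' -> (\det B' = 0) <-> (chart B') _[7] = 0.
  rewrite -det_frame_eq0 /chart_dom /chart /=; move: (frame B') => c [c0 _].
  rewrite mxE /=; split=> [->|/eqP]; first by rewrite mul0r.
  by rewrite mulf_eq0 invr_eq0 expf_eq0 /= (gt_eqF c0) orbF => /eqP.
rewrite eqEsubset; split=> [_ [B' [[VB' domB'] _] <-]|y [y0 y7]].
  split; first by have [] := chart_domP domB'.
  move=> i; case: i => -[|[|[|[|[|[|[|[|//]]]]]]]] lti //= _.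
  have /V7E[_ /(detE _ domB')] := VB'.
  by rewrite (bool_irrelevance lti isT).
have [Sy domy] := chart_inv_dom y0.
exists (chart_inv y); last exact: chart_invK.
split => //; split => //; apply/V7E; split => //.
by apply/detE => //; rewrite chart_invK //; exact: y7.
Qed.

End SliceChart.
End ThreeByThree.

(** * Homeomorphisms between subsets *)

Section Homeomorphisms.
Implicit Types S T Z : topologicalType.

Lemma within_continuousP S T (X : set S) (f : S -> T) :
  {within X, continuous f} <->
  forall x, X x -> f x' @[x' --> within X (nbhs x)] --> f x.
Proof. exact: subspace_continuousP. Qed.

Lemma continuous_at_comp_within S T Z (Y : set T) (phi : S -> T) (f : T -> Z) x :
  {within Y, continuous f} -> continuous_at x phi ->
  (\forall x' \near x, Y (phi x')) -> continuous_at x (f \o phi).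
Proof.
move=> /within_continuousP cf cphi Yphi O /(cf _ (nbhs_singleton Yphi)) fO.
change (nbhs x (fun x' => O (f (phi x')))).
have h : nbhs x (fun x' => Y (phi x') -> O (f (phi x'))) := cphi _ fO.
by apply: (filterS _ (filterI h Yphi)) => x' [h' Yx']; exact: h'.
Qed.

Lemma within_comp S T Z (X : set S) (Y : set T) (f : S -> T) (f' : T -> Z) :
  {within X, continuous f} -> {within Y, continuous f'} -> (f @` X `<=` Y) ->
  {within X, continuous (f' \o f)}.
Proof.
move=> /within_continuousP cf /within_continuousP cf' XY.
apply/within_continuousP => x Xx O.
have Yfx : Y (f x) by apply: XY; exists x.
move=> /(cf' _ Yfx)/(cf _ Xx) fO; rewrite /= /within /=.
have : nbhs x (fun x' => X x' -> Y (f x') -> O (f' (f x'))) := fO.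
by move=> h; apply: (filterS _ h) => x' h' Xx'; apply: h' => //; apply: XY; exists x'.
Qed.

Lemma homeo_img S T (X : set S) (Y : set T) f g x :
  homeomorphism X Y f g -> X x -> Y (f x).
Proof. by case=> <- _ _ _ Xx; exists x. Qed.

Lemma homeo_K S T (X : set S) (Y : set T) f g x :
  homeomorphism X Y f g -> X x -> g (f x) = x.
Proof. by case=> _ fK _ _ Xx; apply: fK; rewrite inE. Qed.

Lemma homeo_sym S T (X : set S) (Y : set T) f g :
  homeomorphism X Y f g -> homeomorphism Y X g f.
Proof.
move=> h; have [fX fK cf cg] := h; split=> // [|y].
  rewrite -fX eqEsubset; split=> [_ [_ [x Xx <-] <-]|x Xx].
    by rewrite (homeo_K h Xx).
  by exists (f x); [exists x|rewrite (homeo_K h Xx)].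
by rewrite inE -fX => -[x Xx <-]; rewrite (homeo_K h Xx).
Qed.

Lemma homeo_comp S T Z (X : set S) (Y : set T) (P : set Z) f g f' g' :
  homeomorphism X Y f g -> homeomorphism Y P f' g' ->
  homeomorphism X P (f' \o f) (g \o g').
Proof.
move=> h h'; have [fX _ cf cg] := h; have [fY _ cf' cg'] := h'.
have [gY _ _ _] := homeo_sym h; have [gP _ _ _] := homeo_sym h'.
split.
- by rewrite -fY -fX image_comp.
- move=> x; rewrite inE => Xx /=.
  by rewrite (homeo_K h' (homeo_img h Xx)) (homeo_K h Xx).
- by apply: within_comp cf cf' _; rewrite fX.
- by apply: within_comp cg' cg _; rewrite gP.
Qed.

Lemma homeo_restr S T (X : set S) (Y : set T) f g (X' : set S) :
  homeomorphism X Y f g ->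
  homeomorphism (X `&` X') (Y `&` g @^-1` X') f g.
Proof.
move=> h; have [fX fK cf cg] := h; split.
- rewrite eqEsubset; split=> [_ [x [Xx X'x] <-]|y [Yy /= X'y]].
    by split; [exact: homeo_img h Xx|rewrite /= (homeo_K h Xx)].
  exists (g y); last by rewrite (homeo_K (homeo_sym h) Yy).
  by split => //; exact: homeo_img (homeo_sym h) Yy.
- by move=> x; rewrite inE => -[Xx _]; exact: homeo_K h Xx.
- by apply: continuous_subspaceW cf => x [].
- by apply: continuous_subspaceW cg => x [].
Qed.

Lemma homeo_eq S T (X X' : set S) (Y Y' : set T) f g :
  X = X' -> Y = Y' -> homeomorphism X Y f g -> homeomorphism X' Y' f g.
Proof. by move=> -> ->. Qed.

Lemma within_preimage S T (X : set S) (f : S -> T) (O : set T) :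
  {within X, continuous f} -> open O ->
  exists2 U : set S, open U & X `&` f @^-1` O = X `&` U.
Proof.
move=> cf oO; have oP : open (f @^-1` O : set (subspace X)).
  by move/continuousP: cf; apply.
have [U oU UE] := (open_subspaceP X (f @^-1` O)).1 oP.
by exists U => //; rewrite setIC -UE setIC.
Qed.

Lemma open_within_preimage S T (X : set S) (f : S -> T) (O : set T) :
  open X -> {within X, continuous f} -> open O -> open (X `&` f @^-1` O).
Proof. by move=> oX cf /(within_preimage cf)[U oU ->]; exact: openI. Qed.

End Homeomorphisms.

(** * Homogeneity of manifolds *)

Section LocallyEuclidean.
Context {R : realType} {V : normedModType R}.
Implicit Types (X : set V).

Definition euclidean_chart (d : nat) X (U : set V) (Y : set 'rV[R]_d) f g :=
  [/\ open U, open Y & homeomorphism (X `&` U) Y f g].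

Definition locally_euclidean_at (d : nat) X (A : V) :=
  exists U (Y : set 'rV[R]_d) f g, U A /\ euclidean_chart X U Y f g.

Lemma manifold_at_locally_euclidean n X N A : X A -> nbhd_in X A N ->
  topological_manifold n N -> locally_euclidean_at n X A.
Proof.
move=> XA [NX nN] mN; move: nN; rewrite /within /= nbhsE => -[G [oG GA] GN].
have NA : N A by exact: GN.
have [W [oW WA [Y [f [g [oY h]]]]]] := mN A NA.
exists (W `&` G), (Y `&` g @^-1` G), f, g; split => //; split.
- exact: openI.
- by have [_ _ _ cg] := h; exact: open_within_preimage.
apply: homeo_eq (homeo_restr G h) => //.
rewrite eqEsubset; split=> x; first by move=> [[/NX Xx Wx] Ox].
by move=> [Xx [Wx Ox]]; do !split => //; exact: GN.
Qed.

Lemma homeo_shift n (tau : 'rV[R]_n) (Y : set 'rV[R]_n) :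
  homeomorphism Y [set y | Y (y - tau)] (fun y => y + tau) (fun y => y - tau).
Proof.
split.
- rewrite eqEsubset; split=> [_ [y Yy <-]|y Yy] /=; first by rewrite addrK.
  by exists (y - tau) => //; rewrite subrK.
- by move=> y _; rewrite addrK.
- apply: continuous_subspaceT => y.
  by apply: continuousD; [exact: cvg_id|exact: cst_continuous].
- apply: continuous_subspaceT => y.
  by apply: continuousB; [exact: cvg_id|exact: cst_continuous].
Qed.

(** In the chart f the translation by f B - f A carries a neighbourhood of A to a
neighbourhood of B; following it by a d-dimensional chart at B gives one at
A. *)
Theorem locally_euclidean_homogeneous n d X U (Y : set 'rV[R]_n) f g A B :
  euclidean_chart X U Y f g -> X A -> U A -> X B -> U B ->
  locally_euclidean_at d X B -> locally_euclidean_at d X A.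
Proof.
move=> [oU oY h] XA UA XB UB [U' [Y' [k [l [U'B [oU' oY' h']]]]]].
have [_ _ cf cg] := h; have [_ _ _ cl] := h'.
pose tau := f B - f A.
have oshift (P : set 'rV[R]_n) (t : 'rV[R]_n) : open P -> open [set z | P (z + t)].
  have ct : continuous (fun z : 'rV[R]_n => z + t).
    by move=> z; apply: continuousD; [exact: cvg_id|exact: cst_continuous].
  by move/continuousP: ct => + oP; exact.
pose Y1 := Y `&` g @^-1` U'.
have oY1 : open Y1 by exact: open_within_preimage.
pose Y2 := Y `&` [set z | Y1 (z + tau)].
have oY2 : open Y2 by apply: openI => //; exact: oshift.
pose Y3 := [set z | Y2 (z - tau)].
have oY3 : open Y3 by exact: oshift.
have [U2 oU2 U2E] := within_preimage cf oY2.
have [U3 oU3 U3E] := within_preimage cf oY3.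
pose Z3 := (X `&` U) `&` f @^-1` Y3.
have Z3U' : Z3 `<=` X `&` U'.
  move=> x [[Xx Ux] [_ /=]]; rewrite subrK => -[_ /=].
  by rewrite (homeo_K h (conj Xx Ux)).
have h2 : homeomorphism (X `&` (U `&` U2)) Y2 f g.
  have := homeo_sym (homeo_restr Y2 (homeo_sym h)).
  by apply: homeo_eq; [rewrite U2E setIA|rewrite /Y2 setIA setIid].
have h3 : homeomorphism Y3 Z3 g f.
  have := homeo_restr Y3 (homeo_sym h); apply: homeo_eq => //.
  rewrite setIidr // => z [_ /=]; rewrite subrK => -[]//.
have h4 : homeomorphism Z3 (Y' `&` l @^-1` (U `&` U3)) k l.
  have := homeo_restr Z3 h'; apply: homeo_eq; first by rewrite setIidr.
  have lX y : Y' y -> X (l y) by move=> /(homeo_img (homeo_sym h'))[].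
  rewrite /Z3 U3E eqEsubset; split=> y [Y'y /=].
    by move=> [[_ ?] ?]; split.
  by move=> [? ?]; split => //; split => //; split => //; exact: lX.
exists (U `&` U2), (Y' `&` l @^-1` (U `&` U3)),
  (k \o (g \o ((fun y => y + tau) \o f))),
  (((g \o (fun y => y - tau)) \o f) \o l).
split.
  split => //; suff [] : (X `&` U `&` U2) A by [].
  rewrite -U2E; split => //=; split; first exact: homeo_img h _.
  rewrite /= /tau addrC subrK; split; first exact: homeo_img h _.
  by rewrite /= (homeo_K h (conj XB UB)).
split.
- exact: openI.
- by apply: open_within_preimage => //; exact: openI.
exact: homeo_comp (homeo_comp (homeo_comp h2 (homeo_shift tau Y2)) h3) h4.
Qed.

End LocallyEuclidean.

(** * Submanifolds are topological manifolds *)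

Section SubmanifoldTopology.
Context {R : realType}.

Lemma smooth_on_continuous (V W : normedModType R) (X : set V) (f : V -> W) :
  smooth_on X f -> {within X, continuous f}.
Proof.
move=> sf; apply/within_continuousP => x Xx.
have [U [F [oU Ux /(_ 0%N) cF Ff]]] := sf x Xx.
rewrite -(Ff x Xx Ux) => O /(cF x Ux) FO.
change (nbhs x (fun y => X y -> O (f y))).
apply: (filterS _ (filterI (open_nbhs_nbhs (conj oU Ux)) FO)) => y [Uy Oy] Xy.
by rewrite -(Ff y Xy Uy).
Qed.

Lemma smooth_within (V W : normedModType R) (X : set V) (f : V -> W) :
  smooth setT f -> {within X, continuous f}.
Proof.
move=> sf; apply: continuous_subspaceT => x.
exact: (@smooth_continuous _ _ _ setT).
Qed.

Lemma homeo_coord_subspace d k (Y : set 'rV[R]_d) : (k <= d)%N -> open Y ->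
  exists (Y' : set 'rV[R]_k) p q, open Y' /\
    homeomorphism (Y `&` coord_subspace k) Y' p q.
Proof.
move=> kd oY.
pose p (y : 'rV[R]_d) : 'rV[R]_k := \row_i y ord0 (widen_ord kd i).
pose q (z : 'rV[R]_k) : 'rV[R]_d :=
  \row_j if insub (val j) is Some i then z ord0 i else 0.
have sp : smooth setT p.
  apply: smooth_mx => [|i j]; first exact: openT.
  by under eq_fun => y do rewrite mxE; exact: smooth_coord.
have sq : smooth setT q.
  apply: smooth_mx => [|i j]; first exact: openT.
  under eq_fun => y do rewrite mxE.
  by case: insubP => [l _ _|_]; [exact: smooth_coord|exact: smooth_cst].
have pq z : p (q z) = z.
  apply/rowP => i; rewrite !mxE; case: insubP => [l _ /= li|].
    by congr (z _ _); exact: val_inj.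
  by rewrite /= ltn_ord.
have qp y : coord_subspace k y -> q (p y) = y.
  move=> yk; apply/rowP => j; rewrite mxE; case: insubP => [l _ /= lj|].
    by rewrite mxE; congr (y _ _); exact: val_inj.
  by rewrite -leqNgt => /yk.
have qk z : coord_subspace k (q z).
  by move=> j kj; rewrite mxE insubF // ltnNge kj.
exists (q @^-1` Y), p, q; split.
  apply: open_comp => // z _; exact: (@smooth_continuous _ _ _ setT).
split; [|by move=> y; rewrite inE => -[_ /qp]|exact: smooth_within..].
rewrite eqEsubset; split=> [_ [y [Yy yk] <-]|z Yz]; first by rewrite /= qp.
by exists (q z).
Qed.

Lemma submanifold_topological (V : normedModType R) d (S : set V) k N :
  submanifold d S k N -> topological_manifold k N.
Proof.
move=> [NS kd chartN] x Nx.
have [W [oW Wx [Y [f [g [oY [fS fK sf sg] fN]]]]]] := chartN x Nx.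
exists W; split => //.
have [Y' [p [q [oY' hp]]]] := homeo_coord_subspace kd oY.
have hS : homeomorphism (S `&` W) Y f g.
  by split => //; exact: smooth_on_continuous.
exists Y', (p \o f), (g \o q); split => //; apply: homeo_comp hp.
apply: homeo_eq (homeo_restr N hS).
  rewrite eqEsubset; split=> y; first by case=> -[].
  by case=> Ny Wy; split => //; split => //; exact: NS.
rewrite -fN eqEsubset; split=> [y [Yy Ny]|_ [y [Ny Wy] <-]].
  exists (g y); last by rewrite (homeo_K (homeo_sym hS) Yy).
  by split => //; have [] := homeo_img (homeo_sym hS) Yy.
have Sy : (S `&` W) y by split => //; exact: NS.
by split; [exact: homeo_img hS Sy|rewrite /= (homeo_K hS Sy)].
Qed.

End SubmanifoldTopology.

(** * Matrices of rank one *)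

Section RankOne.
Context {R : realType}.
Variables (L M A : 'M[R]_3).
Hypotheses (uL : L \in unitmx) (uM : M \in unitmx).
Hypotheses (SA : S8 A) (frameA : frame L M A = mx3 1 0 0 0 0 0 0 0 0).
Local Notation "y '_[' k ]" := (y (ord0 : 'I_1) (@Ordinal 6 k isT)) (at level 3).
Local Notation frame := (frame L M).

(** The matrix with top left entry 1, first row (1, x0, x1), first column
(1, x2, x3) and Schur complement of first column (x4, x5) and second column 0. *)
Definition section_mx (x : 'rV[R]_6) : 'M[R]_3 :=
  mx3 1 x _[0] x _[1]
      x _[2] (x _[4] + x _[2] * x _[0]) (x _[2] * x _[1])
      x _[3] (x _[5] + x _[3] * x _[0]) (x _[3] * x _[1]).

Definition cone_section (x : 'rV[R]_6) : 'M[R]_3 :=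
  to_sphere (L *m section_mx x *m M).

(** The entries of the first row and column, once C00 is scaled to 1, followed by
S11 + S22 and S21 - S12 for the Schur complement S. *)
Definition cone_proj (B : 'M[R]_3) : 'rV[R]_6 :=
  let c i j := frame B i j / frame B i0 i0 in
  \row_(i < 6) nth 0 [:: c i0 i1; c i0 i2; c i1 i0; c i2 i0;
    (c i1 i1 - c i1 i0 * c i0 i1) + (c i2 i2 - c i2 i0 * c i0 i2);
    (c i2 i1 - c i2 i0 * c i0 i1) - (c i1 i2 - c i1 i0 * c i0 i2)] i.

Lemma section_mx_neq0 x : section_mx x != 0.
Proof.
by apply/eqP => /matrixP/(_ i0 i0); rewrite !mxE /= => /eqP; rewrite oner_eq0.
Qed.

Lemma frame_section x :
  exists2 s : R, 0 < s & frame (cone_section x) = s *: section_mx x.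
Proof.
exists (Num.sqrt 3 / Num.sqrt (sqnorm (L *m section_mx x *m M))).
  rewrite divr_gt0 // ?sqrtr_gt0 // sqnorm_gt0 // frame_neq0 //.
  exact: section_mx_neq0.
by rewrite /cone_section frameZ frame_mul.
Qed.

Lemma cone_section_V7 x : V7 (cone_section x).
Proof.
apply/V7E; split.
  by apply: to_sphere_S8; rewrite frame_neq0 // section_mx_neq0.
apply/(det_frame_eq0 uL uM); have [s _ ->] := frame_section x.
by rewrite detZ det3 !mxE /=; ring.
Qed.

Lemma cone_section0 : cone_section 0 = A.
Proof.
have -> : cone_section 0 = to_sphere A.
  rewrite /cone_section; congr to_sphere.
  rewrite -[RHS](frameK uL uM) frameA; congr (_ *m _ *m _).
  by apply: mx3_eq; rewrite !mxE /= ?mxE; ring.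
by rewrite (@to_sphereZ _ 1) ?scale1r.
Qed.

Lemma cone_sectionK x : cone_proj (cone_section x) = x.
Proof.
have [s s0 E] := frame_section x; rewrite /cone_proj E.
have s1 : s != 0 by rewrite gt_eqF.
apply/rowP => i; rewrite !mxE /=.
case: i => -[|[|[|[|[|[|//]]]]]] lti /=; rewrite (bool_irrelevance lti isT);
  by field.
Qed.

Lemma cone_section_chart_dom (x : 'rV[R]_6) : 0 < x _[4] -> chart_dom L M (cone_section x).
Proof.
move=> x4; have [s s0 E] := frame_section x; rewrite /chart_dom /= E !mxE /=.
split; first by rewrite mulr1.
have -> : s * 1 * (s * (x _[4] + x _[2] * x _[0])) - s * x _[0] * (s * x _[2]) =
  s ^+ 2 * x _[4] by ring.
by rewrite mulr_gt0 // exprn_gt0.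
Qed.

(** If S11 = - S22 and S21 = S12, then det S = - (S22 ^ 2 + S12 ^ 2), so a
singular S in the zero set of the projection is 0. *)
Lemma cone_proj_eq0 B : V7 B -> 0 < frame B i0 i0 -> cone_proj B = 0 -> B = A.
Proof.
move=> /V7E[SB /(det_frame_eq0 uL uM)]; have := frameK uL uM B.
rewrite /cone_proj; move: (frame B) => c BE detc c0 /rowP proj0.
have c0' : c i0 i0 != 0 by rewrite gt_eqF.
have coord0 a : a / c i0 i0 = 0 -> a = 0.
  by move/eqP; rewrite mulf_eq0 invr_eq0 (negPf c0') orbF => /eqP.
have := proj0 (@Ordinal 6 0 isT); rewrite !mxE /= => /coord0 c01.
have := proj0 (@Ordinal 6 1 isT); rewrite !mxE /= => /coord0 c02.
have := proj0 (@Ordinal 6 2 isT); rewrite !mxE /= => /coord0 c10.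
have := proj0 (@Ordinal 6 3 isT); rewrite !mxE /= => /coord0 c20.
have := proj0 (@Ordinal 6 4 isT); rewrite !mxE /= c01 c02 c10 c20.
rewrite !mul0r !subr0 -mulrDl => /coord0 /eqP; rewrite addr_eq0 => /eqP c11.
have := proj0 (@Ordinal 6 5 isT); rewrite !mxE /= c01 c02 c10 c20.
rewrite !mul0r !subr0 -mulrBl => /coord0 /eqP; rewrite subr_eq0 => /eqP c21.
have : c i2 i2 ^+ 2 + c i1 i2 ^+ 2 = 0.
  apply/eqP; move/eqP: detc; rewrite det3 c01 c02 c11 c21 !mul0r subr0 addr0.
  by rewrite mulf_eq0 (negPf c0') /= mulNr -opprD oppr_eq0 -!expr2.
move/eqP; rewrite paddr_eq0 ?sqr_ge0 // !sqrf_eq0 => /andP[/eqP c22 /eqP c12].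
have cE : c = c i0 i0 *: frame A.
  rewrite frameA; apply: mx3_eq; rewrite !mxE /= ?mulr0 ?mulr1 //.
    by rewrite c11 c22 oppr0.
  by rewrite c21.
have BA : B = c i0 i0 *: A.
  by rewrite -BE {1}cE -[in RHS](frameK uL uM A) -scalemxAr -scalemxAl.
rewrite {1}BA -(to_sphereZ c0) -?BA //.
by rewrite (@to_sphereZ _ 1) ?scale1r.
Qed.

Lemma smooth_cone_section : smooth setT cone_section.
Proof.
apply: smooth_to_sphere => [|x _|i j]; first exact: openT.
  by rewrite frame_neq0 // section_mx_neq0.
have oT := @openT 'rV[R]_6.
apply: smooth_mulmx => // k l; last exact: smooth_cst.
apply: smooth_mulmx => // p q; first exact: smooth_cst.
have sx r (ltr : (r < 6)%N) :
    smooth setT (fun x : 'rV[R]_6 => x ord0 (Ordinal ltr)).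
  exact: smooth_coord.
under eq_fun => x do rewrite mxE.
case: p => -[|[|[|//]]] /= _; case: q => -[|[|[|//]]] /= _;
  by first [exact: sx|exact: smooth_cst|exact: smoothM|
            apply: smoothD => //; exact: smoothM].
Qed.

Definition cone_dom : set 'M[R]_3 := [set B | 0 < frame B i0 i0].

Lemma open_cone_dom : open cone_dom.
Proof.
apply: (@open_comp _ _ (fun B => frame B i0 i0) [set x | 0 < x]).
  move=> B _; apply: (@smooth_continuous _ _ _ setT) => //.
  exact: (smooth_frame L M i0 i0 (@openT 'M[R]_3)).
exact: open_gt.
Qed.

Lemma smooth_cone_proj : smooth cone_dom cone_proj.
Proof.
have oD := open_cone_dom.
have sc i j : smooth cone_dom (fun B => frame B i j / frame B i0 i0).
  apply: smooth_div => //; [|exact: smooth_frame..].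
  by move=> B; rewrite /cone_dom /= => B0; rewrite gt_eqF.
apply: smooth_mx => // i k; under eq_fun => B do rewrite mxE.
case: k => -[|[|[|[|[|[|//]]]]]] ltk /=; try exact: sc;
  by do ?[apply: smoothD => //|apply: smoothN => //|apply: smoothM => //].
Qed.

(** The section takes a rank 2 value as soon as its coordinate x_4 is positive,
so there are rank 2 points in every neighbourhood of A. *)
Lemma rank1_locally_euclidean n :
  locally_euclidean_at n V7 A -> locally_euclidean_at 7 V7 A.
Proof.
move=> [U [Y [f [g [UA ch]]]]]; have [oU _ _] := ch.
have VA : V7 A by rewrite -cone_section0; exact: cone_section_V7.
have cs : continuous cone_section.
  by move=> x; exact: (smooth_continuous smooth_cone_section).
have [r /= r0 rU] : nbhs_ball 0 (cone_section @^-1` U).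
  apply/nbhs_ballP; apply: cs; apply: open_nbhs_nbhs; split => //.
  by rewrite cone_section0.
pose x : 'rV[R]_6 := (r / 2) *: delta_mx ord0 (@Ordinal 6 4 isT).
pose B := cone_section x.
have UB : U B.
  apply: rU; rewrite -ball_normE /= sub0r normrN; apply/mx_norm_lt => // i j.
  rewrite !mxE normrM gtr0_norm ?divr_gt0 // normr_nat.
  have : r / 2 < r by rewrite ltr_pdivrMr // ltr_pMr // ltr1n.
  by apply: le_lt_trans; rewrite ger_pMr ?divr_gt0 // lern1 leq_b1.
apply: (locally_euclidean_homogeneous ch VA UA (cone_section_V7 x) UB).
have domB : chart_dom L M B.
  by apply: cone_section_chart_dom; rewrite !mxE /= mulr1 divr_gt0.
have [W [oW WB [Y' [k [l [oY' h']]]]]] :=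
  submanifold_topological (slice_submanifold uL uM) (conj (cone_section_V7 x) domB).
exists (chart_dom L M `&` W), Y', k, l; split => //; split => //.
  by apply: openI => //; exact: open_chart_dom.
by rewrite setIA.
Qed.

Theorem rank1_not_manifold : ~ manifold_at V7 A.
Proof.
move=> [N [n [nN mN]]].
have VA : V7 A by rewrite -cone_section0; exact: cone_section_V7.
have := rank1_locally_euclidean (manifold_at_locally_euclidean VA nN mN).
move=> [U [Y [f [g [UA [oU oY h]]]]]].
have [_ _ cf cg] := h.
have cs x : continuous_at x cone_section.
  exact: (smooth_continuous smooth_cone_section).
pose a x := f (cone_section x) - f A.
pose b y := cone_proj (g (y + f A)).
have nU : nbhs (0 : 'rV[R]_6) (fun x => (V7 `&` U) (cone_section x)).
  have : nbhs (0 : 'rV[R]_6) (cone_section @^-1` U).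
    by apply: cs; apply: open_nbhs_nbhs; split => //; rewrite cone_section0.
  by apply: filterS => x Ux; split => //; exact: cone_section_V7.
have cshift (y : 'rV[R]_7) : continuous_at y (fun y => y + f A).
  by apply: continuousD; [exact: cvg_id|exact: cst_continuous].
have YA : Y (f A) by exact: homeo_img h _.
have nY : nbhs (0 : 'rV[R]_7) (fun y => Y (y + f A)).
  by apply: cshift; apply: open_nbhs_nbhs; split => //; rewrite add0r.
have cgs : nbhs (0 : 'rV[R]_7) (fun y => continuous_at y (fun y => g (y + f A))).
  apply: filterS (nbhs_interior nY) => y Yy.
  exact: (continuous_at_comp_within cg (cshift y) Yy).
have g0 : g (0 + f A) = A by rewrite add0r (homeo_K h).
have domA : cone_dom A by rewrite /cone_dom /= frameA mxE.
have nD : nbhs (0 : 'rV[R]_7) (fun y => cone_dom (g (y + f A))).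
  apply: (nbhs_singleton cgs); apply: open_nbhs_nbhs; split.
    exact: open_cone_dom.
  by rewrite g0.
suff : (7 <= 6)%N by [].
apply: (@stable_section_dim _ 6 7 a b).
- apply: filterS (nbhs_interior nU) => x Ux.
  apply: continuousB; last exact: cst_continuous.
  exact: (continuous_at_comp_within cf (cs x) Ux).
- apply: filterS (filterI cgs nD) => y [cy Dy].
  apply: (continuous_comp cy).
  exact: (smooth_continuous smooth_cone_proj Dy).
- apply: filterS nU => x Ux.
  by rewrite /b /a subrK (homeo_K h Ux) cone_sectionK.
- by rewrite /a cone_section0 subrr.
- apply: filterS (filterI nY nD) => y [Yy Dy] by0.
  have [Vg _] := homeo_img (homeo_sym h) Yy.
  have /(congr1 f) := cone_proj_eq0 Vg Dy by0.
  rewrite (homeo_K (homeo_sym h) Yy) => yA.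
  by rewrite -[y](addrK (f A)) yA subrr.
Qed.

End RankOne.

(** * The two strata *)

Section Ranks.
Context {R : realType}.
Implicit Types A : 'M[R]_3.

Lemma frame_ebase A :
  frame (col_ebase A) (row_ebase A) A = pid_mx (\rank A).
Proof.
by rewrite -{3}(mulmx_ebase A) frame_mul ?col_ebase_unit ?row_ebase_unit.
Qed.

Lemma submanifold_at_rank2 A : V7 A -> \rank A = 2%N -> submanifold_at 8 S8 V7 A.
Proof.
move=> VA rA; pose L := col_ebase A; pose M := row_ebase A.
have uL : L \in unitmx by exact: col_ebase_unit.
have uM : M \in unitmx by exact: row_ebase_unit.
exists (V7 `&` chart_dom L M), 7%N; split; last exact: slice_submanifold.
split; first by move=> ? [].
have domA : chart_dom L M A.
  rewrite /chart_dom /= /L /M frame_ebase rA !mxE /=.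
  by rewrite mulr1 mulr0 subr0 ltr01.
have : nbhs A (chart_dom L M).
  by apply: open_nbhs_nbhs; split => //; exact: open_chart_dom.
by apply: filterS => B domB VB; split.
Qed.

Lemma not_manifold_at_rank1 A : V7 A -> \rank A = 1%N -> ~ manifold_at V7 A.
Proof.
move=> /V7E[SA _] rA.
apply: (@rank1_not_manifold _ (col_ebase A) (row_ebase A)) => //.
- exact: col_ebase_unit.
- exact: row_ebase_unit.
- by rewrite frame_ebase rA; apply: mx3_eq; rewrite !mxE.
Qed.

Lemma submanifold_at_manifold_at (V : normedModType R) d (S X : set V) (A : V) :
  submanifold_at d S X A -> manifold_at X A.
Proof.
move=> [N [k [nN sN]]]; exists N, k; split => //.
exact: submanifold_topological sN.
Qed.

Lemma V7_rank A : V7 A -> \rank A = 1%N \/ \rank A = 2%N.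
Proof.
move=> /V7E[/S8E nA dA].
have : (\rank A <= 3)%N by exact: rank_leq_row.
case rA : (\rank A) => [|[|[|[|//]]]] _; [|by left|by right|].
  move/eqP: rA; rewrite mxrank_eq0 => /eqP A0; move: nA.
  rewrite A0 /sqnorm big1 => [|i _]; last by rewrite big1 // => j _; rewrite mxE expr0n.
  by move/eqP; rewrite eq_sym pnatr_eq0.
have : A \in unitmx by rewrite -row_free_unit /row_free rA.
by rewrite unitmxE dA unitr0.
Qed.

Lemma rank1_V7 A : M4 A -> V7 A.
Proof.
move=> [SA rA]; apply/V7E; split => //; apply/eqP/negPn; rewrite -unitfE -unitmxE.
by rewrite -row_free_unit /row_free rA.
Qed.

End Ranks.

Theorem mainTheorem2 (R : realType) :
  [/\ [set A : 'M[R]_3 | V7 A /\ ~ submanifold_at 8 S8 V7 A] = M4,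
      forall A : 'M[R]_3, V7 A -> \rank A = 2%N -> submanifold_at 8 S8 V7 A &
      forall A : 'M[R]_3, V7 A -> \rank A = 1%N -> ~ manifold_at V7 A].
Proof.
split; [|exact: submanifold_at_rank2|exact: not_manifold_at_rank1].
rewrite eqEsubset; split=> A.
  move=> [VA nsA]; split; first by have [] := (V7E A).1 VA.
  by case: (V7_rank VA) => // /(submanifold_at_rank2 VA).
move=> MA; have VA := rank1_V7 MA; split => //.
by move/submanifold_at_manifold_at; apply: not_manifold_at_rank1 => //; case: MA.
Qed.
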